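(* Let $n\ge 1$, $T>0$. Assume the following. (1) $K\subseteq\mathbb{R}^n$ is a closed convex cone with vertex at the origin, $D\subset\mathbb{R}^n$ is a non-empty convex domain (open, connected) with $D\neq\mathbb{R}^n$, and either (a) $D$ is bounded and $K=\mathbb{R}^n$, or (b) $D$ is conic with vertex at the origin (i.e. $\lambda x\in D$ for all $x\in D$, $\lambda>0$) and $D-K:=\{\eta-\xi:\eta\in D,\ \xi\in K\}=\mathbb{R}^n$. (2) $f:[0,T]\times\mathbb{R}^n\to\mathbb{R}^n$ is continuous and for a constant $L>0$: $|f(t,x)-f(t,x')|\le L|x-x'|$ and $|f(t,0)|\le L$ for all $t\in[0,T]$, $x,x'\in\mathbb{R}^n$. (3) $g:[0,T]\times\mathbb{R}^n\to[0,\infty)$ and $h:\mathbb{R}^n\to[0,\infty)$ are continuous, and for constants $L,\mu>0$ and $0<\delta\le1$: $0\le g(t,x),h(x)\le L(1+|x|^{\mu+\delta})$ and $|g(t,x)-g(t,x')|,\ |h(x)-h(x')|\le L(1+|x|^\mu\vee|x'|^\mu)|x-x'|^\delta$ for all $t\in[0,T]$, $x,x'\in\mathbb{R}^n$. (4) $\ell:[0,T]\times\mathbb{R}^n\times K\to(0,\infty)$ is continuous, and there are constants $\ell_0,\delta_0>0$, $\beta\in(0,1]$, the same $L,\mu,\delta$ as in (3), and continuous decreasing functions $\alpha_0,\alpha:[0,T]\to(0,\infty)$ such that for all $t,t'\in[0,T]$, $x,x'\in\mathbb{R}^n$, $\xi,\xi'\in K$: $$\ell_0+\alpha_0(t)|\xi|^\beta\le\ell(t,x,\xi)\le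 L+\alpha(t)|\xi|^\beta,$$ $$|\ell(t,x,\xi)-\ell(t,x',\xi)|\le L(1+|x|^\mu\vee|x'|^\mu)|x-x'|^\delta,$$ $$\min\{\ell(t,x,\xi)+\ell(t,x+\xi,\xi'),\ \ell(t,x,\xi')+\ell(t,x+\xi',\xi)\}-\ell(t,x,\xi+\xi')\ge\delta_0,$$ $$\ell(t,x,\xi)-L|t-t'|\le\ell(t',x,\xi)\le\ell(t,x,\xi)\quad\text{if } t\le t'.$$ (5) $$\inf_{\xi\in K,\ x+\xi\in D}\big[h(x+\xi)+\ell(T,x,\xi)\big]<h(x)\qquad\text{for all }x\in\mathbb{R}^n\setminus D.$$ Let $V$ be the value function of the terminal-state-constrained impulse control problem described in the context, and suppose that $V\in C^1([0,T]\times\mathbb{R}^n)$. Then $V$ satisfies $$\begin{cases}V_t(t,x)+\langle V_x(t,x),f(t,x)\rangle+g(t,x)\ge0,\quad \mathbf N[V](t,x)-V(t,x)\ge0,&(t,x)\in[0,T]\times\mathbb{R}^n,\\ \big(V_t(t,x)+\langle V_x(t,x),f(t,x)\rangle+g(t,x)\big)\big(\mathbf N[V](t,x)-V(t,x)\big)=0,&(t,x)\in[0,T]\times\mathbb{R}^n,\\ V(T,x)=h^D(x),&x\in\mathbb{R}^n,\end{cases}$$ which can also be written as $$\begin{cases}\min\big\{V_t(t,x)+\langle V_x(t,x),f(t,x)\rangle+g(t,x),\ \mathbf N[V](t,x)-V(t,x)\big\}=0,&(t,x)\in[0,T)\times\mathbb{R}^n,\\ V(T,x)=h^D(x),&x\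in\mathbb{R}^n.\end{cases}$$
   Context: Impulse control problem. For $t\in[0,T]$, an impulse control on $[t,T]$ is a finite (possibly empty) list of pairs $(\tau_k,\xi_k)_{1\le k\le N}$ with $t\le\tau_1\le\dots\le\tau_N\le T$ and $\xi_k\in K$, identified with $\xi(s)=\sum_{k}\xi_k\mathbf 1_{[\tau_k,T]}(s)$, $s\in[t,T]$ (several impulses at one time are allowed, and zero impulses $\xi_k=0$ are allowed but still incur a cost). $\mathscr K[t,T]$ is the set of all of them. For $(t,x)\in[0,T]\times\mathbb{R}^n$ and $\xi(\cdot)\in\mathscr K[t,T]$, $X(\cdot)=X(\cdot;t,x,\xi(\cdot))$ is the unique (right-continuous) solution of $$X(s)=x+\int_t^sf(r,X(r))\,dr+\xi(s),\qquad s\in[t,T].$$ The set of admissible controls is $\mathscr K^x[t,T]=\{\xi(\cdot)\in\mathscr K[t,T]: X(T;t,x,\xi(\cdot))\in\bar D\}$. The cost functional is $$J(t,x;\xi(\cdot))=\int_t^Tg(s,X(s))\,ds+h(X(T))+\sum_{k}\ell(\tau_k,\tilde X(\tau_k-0),\xi_k),$$ where $\tilde X(\tau_k-0)$ is the state just before the $k$-th impulse is applied: the left limit $X(\tau_k-0)$ (equal to $x$ if $\tau_k=t$) plus the sum of the impulses with smaller index made at the same time $\tau_k$. The value function is $V(t,x)=\inf_{\xi(\cdot)\in\mathscr K^x[t,T]}J(t,x;\xi(\cdot))$, with $\inf\varnothing=+\infty$. Notation: $a\vee b=\max\{a,b\}$. Operators: $\mathbf N[V](t,x)=\min_{\xi\in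 K}\{V(t,x+\xi)+\ell(t,x,\xi)\}$; $\mathbf N^D[h](x)=\min_{\xi\in K,\,x+\xi\in\bar D}\{h(x+\xi)+\ell(T,x,\xi)\}$; $h^D(x)=\min\{h(x),\mathbf N^D[h](x)\}$ for $x\in\bar D$ and $h^D(x)=\mathbf N^D[h](x)$ for $x\in\mathbb{R}^n\setminus\bar D$. *)

(* Defs.v *)
From HB Require Import structures.
From mathcomp Require Import all_boot all_order all_algebra.
From mathcomp Require Import all_classical all_reals all_analysis.

Set Implicit Arguments.
Unset Strict Implicit.
Unset Printing Implicit Defensive.

Import Order.TTheory GRing.Theory Num.Theory.
Import numFieldNormedType.Exports.

Local Open Scope classical_set_scope.
Local Open Scope ring_scope.

(* Functions whose natural
   domain is [0, T] x R^n (or [0, T] x R^n x K) are total functions that are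
   only constrained, and only used, on that domain. *)

Definition dot (R : realType) (n : nat) (u v : 'rV[R]_n) : R :=
  \sum_(i < n) u 0 i * v 0 i.

(* The Euclidean norm; the library norm `|x| on 'rV[R]_n is the sup norm
   (it induces the same topology and the same bounded sets). *)
Definition enorm (R : realType) (n : nat) (x : 'rV[R]_n) : R :=
  Num.sqrt (dot x x).

Notation leb R := (@lebesgue_measure R).

Definition slab (R : realType) (n : nat) (T : R) : set (R * 'rV[R]_n) :=
  `[0, T]%classic `*` setT.

Definition has_min (R : realType) (S : set R) : Prop :=
  exists2 m, S m & lbound S m.

Definition closed_convex_cone (R : realType) (n : nat) (K : set 'rV[R]_n) :
    Prop :=
  [/\ K 0, closed K, convex_set K &
      forall (c : R) (xi : 'rV[R]_n), 0 <= c -> K xi -> K (c *: xi)].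

Definition convex_domain (R : realType) (n : nat) (D : set 'rV[R]_n) : Prop :=
  [/\ D !=set0, open D, connected D & convex_set D].

Definition target_condition (R : realType) (n : nat) (K D : set 'rV[R]_n) :
    Prop :=
  [/\ closed_convex_cone K, convex_domain D, D != setT &
      (bounded_set D /\ K = setT) \/
      ((forall (c : R) (x : 'rV[R]_n), 0 < c -> D x -> D (c *: x)) /\
       [set p.1 - p.2 | p in D `*` K] = setT)].

Definition drift_condition (R : realType) (n : nat) (T L : R)
    (f : R -> 'rV[R]_n -> 'rV[R]_n) : Prop :=
  [/\ {within @slab R n T, continuous (fun p => f p.1 p.2)},
      forall t x x', 0 <= t <= T ->
        enorm (f t x - f t x') <= L * enorm (x - x') &
      forall t, 0 <= t <= T -> enorm (f t 0) <= L].

Definition holder_bound (R : realType) (n : nat) (L mu delta : R)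
    (x x' : 'rV[R]_n) : R :=
  L * (1 + Num.max (enorm x `^ mu) (enorm x' `^ mu)) * enorm (x - x') `^ delta.

Definition running_cost_condition (R : realType) (n : nat) (T L mu delta : R)
    (g : R -> 'rV[R]_n -> R) : Prop :=
  [/\ {within @slab R n T, continuous (fun p => g p.1 p.2)},
      forall t x, 0 <= t <= T ->
        0 <= g t x <= L * (1 + enorm x `^ (mu + delta)) &
      forall t x x', 0 <= t <= T ->
        `|g t x - g t x'| <= holder_bound L mu delta x x'].

Definition terminal_cost_condition (R : realType) (n : nat) (L mu delta : R)
    (h : 'rV[R]_n -> R) : Prop :=
  [/\ continuous h,
      forall x, 0 <= h x <= L * (1 + enorm x `^ (mu + delta)) &
      forall x x', `|h x - h x'| <= holder_bound L mu delta x x'].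

(* Decreasing in the weak sense (nonincreasing). *)
Definition positive_decreasing (R : realType) (T : R) (a : R -> R) : Prop :=
  [/\ {within `[0, T], continuous a},
      forall t, 0 <= t <= T -> 0 < a t &
      forall s t, 0 <= s -> s <= t -> t <= T -> a t <= a s].

(* l t x xi is the cost of the impulse xi at time t in state x. *)
Definition impulse_cost_condition (R : realType) (n : nat)
    (T L mu delta l0 delta0 beta : R) (alpha0 alpha : R -> R)
    (K : set 'rV[R]_n) (l : R -> 'rV[R]_n -> 'rV[R]_n -> R) : Prop :=
  {within @slab R n T `*` K, continuous (fun p => l p.1.1 p.1.2 p.2)} /\
  (forall t x xi, 0 <= t <= T -> K xi -> 0 < l t x xi) /\
  (forall t x xi, 0 <= t <= T -> K xi ->
     l0 + alpha0 t * enorm xi `^ beta <= l t x xi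
       <= L + alpha t * enorm xi `^ beta) /\
  (forall t x x' xi, 0 <= t <= T -> K xi ->
     `|l t x xi - l t x' xi| <= holder_bound L mu delta x x') /\
  (forall t x xi xi', 0 <= t <= T -> K xi -> K xi' ->
     Num.min (l t x xi + l t (x + xi) xi') (l t x xi' + l t (x + xi') xi)
       - l t x (xi + xi') >= delta0) /\
  (forall t t' x xi, 0 <= t -> t <= t' -> t' <= T -> K xi ->
     l t x xi - L * `|t - t'| <= l t' x xi <= l t x xi).

(* Under target_condition the infimum is over a nonempty set, so the junk value of
   inf plays no role. *)
Definition terminal_impulse_condition (R : realType) (n : nat) (T : R)
    (K D : set 'rV[R]_n) (h : 'rV[R]_n -> R)
    (l : R -> 'rV[R]_n -> 'rV[R]_n -> R) : Prop :=
  forall x, ~ D x ->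
    inf [set h (x + xi) + l T x xi | xi in [set xi | K xi /\ D (x + xi)]] < h x.

(* The list of the pairs (tau_k, xi_k), in order of application. *)
Definition impulse_control (R : realType) (n : nat) (T : R) (K : set 'rV[R]_n)
    (t : R) (xi : seq (R * 'rV[R]_n)) : Prop :=
  sorted <=%R (map fst xi) /\
  forall p, p \in xi -> t <= p.1 <= T /\ K p.2.

Definition impulse_path (R : realType) (n : nat) (xi : seq (R * 'rV[R]_n))
    (s : R) : 'rV[R]_n :=
  \sum_(p <- xi | p.1 <= s) p.2.

(* X solves the controlled state equation on [t, T].  Integrability is required
   because the library integral is total.  The values of X outside [t, T] are
   irrelevant; on [t, T] the equation forces right-continuity and, for a
   Lipschitz drift, uniqueness. *)
Definition trajectory (R : realType) (n : nat) (T : R)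
    (f : R -> 'rV[R]_n -> 'rV[R]_n) (t : R) (x : 'rV[R]_n)
    (xi : seq (R * 'rV[R]_n)) (X : R -> 'rV[R]_n) : Prop :=
  (forall i, (leb R).-integrable `[t, T] (EFin \o (fun r => f r (X r) 0 i))) /\
  (forall s, t <= s <= T ->
     X s = x + \row_i (\int[leb R]_(r in `[t, s]) f r (X r) 0 i)
             + impulse_path xi s).

(* The state just before the impulse of index k (counted from 0). *)
Definition pre_impulse_state (R : realType) (n : nat) (t : R) (x : 'rV[R]_n)
    (xi : seq (R * 'rV[R]_n)) (X : R -> 'rV[R]_n) (k : nat) : 'rV[R]_n :=
  let tau j := (nth (0, 0) xi j).1 in
  (if tau k == t then x else lim (X s @[s --> (tau k)^'-])) +
  \sum_(j < k | tau j == tau k) (nth (0, 0) xi j).2.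

Definition cost (R : realType) (n : nat) (T : R) (g : R -> 'rV[R]_n -> R)
    (h : 'rV[R]_n -> R) (l : R -> 'rV[R]_n -> 'rV[R]_n -> R)
    (t : R) (x : 'rV[R]_n) (xi : seq (R * 'rV[R]_n)) (X : R -> 'rV[R]_n) : R :=
  \int[leb R]_(s in `[t, T]) g s (X s) + h (X T) +
  \sum_(k < size xi)
     l (nth (0, 0) xi k).1 (pre_impulse_state t x xi X k) (nth (0, 0) xi k).2.

Definition value (R : realType) (n : nat) (T : R) (K D : set 'rV[R]_n)
    (f : R -> 'rV[R]_n -> 'rV[R]_n) (g : R -> 'rV[R]_n -> R)
    (h : 'rV[R]_n -> R) (l : R -> 'rV[R]_n -> 'rV[R]_n -> R)
    (t : R) (x : 'rV[R]_n) : \bar R :=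
  ereal_inf [set c | exists (xi : seq (R * 'rV[R]_n)) (X : R -> 'rV[R]_n),
    [/\ impulse_control T K t xi, trajectory T f t x xi X, closure D (X T) &
        c = (cost T g h l t x xi X)%:E]].

(* Derivative in t relative to [0, T]: one-sided at t = 0 and t = T. *)
Definition time_quotient (R : realType) (n : nat) (V : R -> 'rV[R]_n -> R)
    (t : R) (x : 'rV[R]_n) : R -> R :=
  fun s => (s - t)^-1 * (V s x - V t x).

Definition time_derivable (R : realType) (n : nat) (T : R)
    (V : R -> 'rV[R]_n -> R) (t : R) (x : 'rV[R]_n) : Prop :=
  cvg (time_quotient V t x s @[s --> within `[0, T]%classic t^']).

Definition time_derivative (R : realType) (n : nat) (T : R)
    (V : R -> 'rV[R]_n -> R) (t : R) (x : 'rV[R]_n) : R :=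
  lim (time_quotient V t x s @[s --> within `[0, T]%classic t^']).

Definition space_gradient (R : realType) (n : nat) (V : R -> 'rV[R]_n -> R)
    (t : R) (x : 'rV[R]_n) : 'rV[R]_n :=
  \row_i 'D_(delta_mx 0 i) (V t) x.

Definition C1_slab (R : realType) (n : nat) (T : R) (V : R -> 'rV[R]_n -> R) :
    Prop :=
  [/\ forall t x, 0 <= t <= T -> time_derivable T V t x,
      forall t x i, 0 <= t <= T -> derivable (V t) x (delta_mx 0 i),
      {within @slab R n T, continuous (fun p => V p.1 p.2)},
      {within @slab R n T, continuous (fun p => time_derivative T V p.1 p.2)} &
      {within @slab R n T, continuous (fun p => space_gradient V p.1 p.2)}].

Definition HJ (R : realType) (n : nat) (T : R)
    (f : R -> 'rV[R]_n -> 'rV[R]_n) (g : R -> 'rV[R]_n -> R)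
    (V : R -> 'rV[R]_n -> R) (t : R) (x : 'rV[R]_n) : R :=
  time_derivative T V t x + dot (space_gradient V t x) (f t x) + g t x.

(* N[V](t, x) and N^D[h](x) are minima of sets of values.  They are defined as
   infima; that each infimum is a minimum is expressed by has_min. *)
Definition Nset (R : realType) (n : nat) (K : set 'rV[R]_n)
    (l : R -> 'rV[R]_n -> 'rV[R]_n -> R) (V : R -> 'rV[R]_n -> R)
    (t : R) (x : 'rV[R]_n) : set R :=
  [set V t (x + xi) + l t x xi | xi in K].

Definition Nop (R : realType) (n : nat) (K : set 'rV[R]_n)
    (l : R -> 'rV[R]_n -> 'rV[R]_n -> R) (V : R -> 'rV[R]_n -> R)
    (t : R) (x : 'rV[R]_n) : R :=
  inf (Nset K l V t x).

Definition NDset (R : realType) (n : nat) (T : R) (K D : set 'rV[R]_n)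
    (l : R -> 'rV[R]_n -> 'rV[R]_n -> R) (h : 'rV[R]_n -> R)
    (x : 'rV[R]_n) : set R :=
  [set h (x + xi) + l T x xi | xi in [set xi | K xi /\ closure D (x + xi)]].

Definition NDop (R : realType) (n : nat) (T : R) (K D : set 'rV[R]_n)
    (l : R -> 'rV[R]_n -> 'rV[R]_n -> R) (h : 'rV[R]_n -> R)
    (x : 'rV[R]_n) : R :=
  inf (NDset T K D l h x).

Definition hD (R : realType) (n : nat) (T : R) (K D : set 'rV[R]_n)
    (l : R -> 'rV[R]_n -> 'rV[R]_n -> R) (h : 'rV[R]_n -> R)
    (x : 'rV[R]_n) : R :=
  if x \in closure D then Num.min (h x) (NDop T K D l h x)
  else NDop T K D l h x.

(* Main.v *)
(* Dynamic programming.  Prepending the impulse (t, z) to a control from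
   (t, x + z) gives V(t, x) <= V(t, x + z) + l(t, x, z), i.e. N[V] >= V, and
   letting the state drift from t to s before applying a control from time s
   gives V(t, x) <= int_t^s g + V(s, X(s)).  By the first-order expansion of V
   along the drift, V(s, X(s)) - V(t, x) + int_t^s g = (s - t) (HJ(t, x) + o(1)),
   so HJ >= 0.  If both HJ(t, x) and N[V](t, x) - V(t, x) were positive, they
   would be bounded below near (t, x), uniformly over the jumps because large
   jumps are too expensive; then every control would exceed V(t, x) by a fixed
   amount, whether its first impulse comes soon or late.  The case t = T follows
   by continuity in t.  At t = T only impulses at time T remain, and by
   subadditivity of l they may be merged into a single one. *)
Require Import Defs.
From mathcomp Require Import all_boot all_order all_algebra.
From mathcomp Require Import all_classical all_reals all_analysis.
From mathcomp Require Import measurable_realfun lra ring.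

Set Implicit Arguments.
Unset Strict Implicit.
Unset Printing Implicit Defensive.

Import Order.TTheory GRing.Theory Num.Theory.
Import numFieldNormedType.Exports.

Local Open Scope classical_set_scope.
Local Open Scope ring_scope.

(** * Norms, continuity on the slab, integrals over intervals *)

(** The infimum in [value] ranges over pairs of a control and its state, so a near-optimal control
    brings its own trajectory; before [T], the only solution to be constructed is the impulse-free
    drift over one short interval ([picard]). The recurring obstacle is the time [s] at which a path
    is cut: [X s] may already contain impulses made at [s]. Cuts therefore go through
    [drift_path f t x X s], where they are left out, and bounds along a path are asked on
    [t <= r < s], the endpoint having measure zero. The expansion must serve all controls at once:
    before its first impulse a state stays within a distance of [x] that depends only on [s - t],
    [x] and the constant of [f] ([short_time_bound]), so one horizon works for every control.
    [C1_slab] speaks of partial derivatives, hence [V] is expanded coordinate by coordinate and then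
    in time, by the mean value theorem. *)

Section Norms.
Context {R : realType} {n : nat}.
Implicit Types x y : 'rV[R]_n.

Lemma coord_le_norm x i : `|x 0 i| <= `|x|.
Proof.
by rewrite [leRHS]/Num.norm/= mx_normrE; apply/bigmax_geP; right; exists (0, i).
Qed.

Lemma norm_rV_le x c : 0 <= c -> (forall i, `|x 0 i| <= c) -> `|x| <= c.
Proof.
move=> c0 xc; rewrite [leLHS]/Num.norm/= mx_normrE; apply/bigmax_leP; split=> //.
by move=> [i j] _ /=; rewrite (ord1 i).
Qed.

Lemma norm_le_enorm x : `|x| <= enorm x.
Proof.
apply: norm_rV_le => [|i]; first exact: sqrtr_ge0.
rewrite -sqrtr_sqr ler_wsqrtr// /dot (bigD1 i)//= -expr2 lerDl.
by apply: sumr_ge0 => j _; rewrite -expr2 sqr_ge0.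
Qed.

(** Summing the squares gives the factor [n] under the root; it is enlarged to its square so that no
    root of [n] remains. *)
Lemma enorm_le_norm x : enorm x <= n%:R * `|x|.
Proof.
have n0 : 0 <= n%:R * `|x| by rewrite mulr_ge0.
rewrite -[leRHS]ger0_norm// -sqrtr_sqr ler_wsqrtr//.
apply: (@le_trans _ _ (\sum_(i < n) `|x| ^+ 2)).
  apply: ler_sum => i _; rewrite -expr2 -[leLHS]ger0_norm ?sqr_ge0// normrX.
  by rewrite lerXn2r ?nnegrE// coord_le_norm.
rewrite sumr_const card_ord -[leLHS]mulr_natl exprMn ler_wpM2r ?sqr_ge0//.
by case: n => [|m]; rewrite ?expr0n//= ler_eXnr// ler1n.
Qed.

End Norms.

Section SlabContinuity.
Context {R : realType} {n : nat} (T : R).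

Lemma slab_continuityP (W : normedModType R) (F : R -> 'rV[R]_n -> W) t x e :
  {within slab T, continuous (fun p => F p.1 p.2)} -> 0 <= t <= T -> 0 < e ->
  exists2 d, 0 < d & forall t' x', 0 <= t' <= T -> `|t' - t| < d ->
    `|x' - x| < d -> `|F t' x' - F t x| < e.
Proof.
move=> /subspace_continuousP cF tT e0.
have /cF/cvgrPdist_lt/(_ _ e0) : slab T (t, x).
  by split => //=; rewrite in_itv.
rewrite near_withinE => -[[A B]] /= [/nbhs_ballP[d1 d10 Ad] /nbhs_ballP[d2 d20 Bd]] AB.
exists (Num.min d1 d2); first by rewrite lt_min d10.
move=> t' x' t'T; rewrite !lt_min => /andP[t1 _] /andP[_ x2].
rewrite distrC; apply: (AB (t', x')).
  by split; [apply: Ad|apply: Bd];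
    rewrite -ball_normE/= distrC.
by split => //=; rewrite in_itv.
Qed.

Lemma slab_continuous_path (W : normedModType R) (F : R -> 'rV[R]_n -> W)
    (a b : R) (X : R -> 'rV[R]_n) :
  {within slab T, continuous (fun p => F p.1 p.2)} -> 0 <= a -> b <= T ->
  {within `[a, b], continuous X} ->
  {within `[a, b], continuous (fun r => F r (X r))}.
Proof.
move=> cF a0 bT /subspace_continuousP cX; apply/subspace_continuousP => r rab.
move: (rab); rewrite /= in_itv/= => /andP[ar rb].
apply/cvgrPdist_lt => e e0.
have rT : 0 <= r <= T by rewrite (le_trans a0)//= (le_trans rb).
have [d d0 dF] := slab_continuityP (X r) cF rT e0.
move/cvgrPdist_lt : (cX _ rab) => /(_ _ d0).
rewrite !near_withinE => Xr; near=> q => qab.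
rewrite distrC; apply: dF.
- move: qab; rewrite /= in_itv/= => /andP[aq qb].
  by rewrite (le_trans a0)//= (le_trans qb).
- rewrite distrC.
  near: q; exact: (@cvgr_dist_lt _ _ _ _ _ id).
- by rewrite distrC; move: qab; near: q.
Unshelve. all: by end_near. Qed.

Lemma slab_continuous_slice (W : normedModType R) (F : R -> 'rV[R]_n -> W) t :
  {within slab T, continuous (fun p => F p.1 p.2)} -> 0 <= t <= T ->
  continuous (F t).
Proof.
move=> cF tT y.
apply/(@cvgrPdist_lt _ _ _ (nbhs y) (nbhs_filter y)) => e e0.
have [d d0 dP] := slab_continuityP y cF tT e0.
apply/nbhs_ballP; exists d => // y'; rewrite -ball_normE/= => yd.
by rewrite distrC; apply: dP; rewrite ?subrr ?normr0// distrC.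
Qed.

End SlabContinuity.

Section IntervalIntegrals.
Context {R : realType}.
Implicit Types (a b c : R) (u v : R -> R).

Lemma integrable_itvS a b a' b' u : a' <= a -> b <= b' ->
  (leb R).-integrable `[a', b'] (EFin \o u) ->
  (leb R).-integrable `[a, b] (EFin \o u).
Proof.
move=> aa bb; apply: integrableS => //.
by apply: subset_itv; rewrite bnd_simp.
Qed.

Lemma integral_itv_split a b c u : a <= b -> b <= c ->
  (leb R).-integrable `[a, c] (EFin \o u) ->
  \int[leb R]_(r in `[a, c]) u r =
  \int[leb R]_(r in `[a, b]) u r + \int[leb R]_(r in `[b, c]) u r.
Proof.
move=> ab bc iu.
rewrite -(@Rintegral_itv_obnd_cbnd _ b); last first.
  by apply: integrableS iu => //; apply: subset_itv; rewrite bnd_simp.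
by rewrite -(@Rintegral_itvB _ u (BLeft a) (BRight c) b)// addrC subrK.
Qed.

Lemma integrable_setU d (S : measurableType d)
    (mu : {measure set S -> \bar R}) (A B : set S) (f : S -> \bar R) :
  measurable A -> measurable B -> [disjoint A & B] ->
  mu.-integrable A f -> mu.-integrable B f -> mu.-integrable (A `|` B) f.
Proof.
move=> mA mB AB /integrableP[mf fA] /integrableP[mfB fB].
have mU := iffRL (measurable_funU _ mA mB) (conj mf mfB).
apply/integrableP; split=> //.
rewrite ge0_integral_setU//=; first exact: lte_add_pinfty.
exact: measurableT_comp.
Qed.

Lemma integrable_itv_cat a b c u : a <= b -> b <= c ->
  (leb R).-integrable `[a, b] (EFin \o u) ->
  (leb R).-integrable `[b, c] (EFin \o u) ->
  (leb R).-integrable `[a, c] (EFin \o u).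
Proof.
move=> ab bc.
have -> : `[a, c]%classic = `[a, b[ `|` `[b, c].
  by rewrite -itv_bndbnd_setU ?bnd_simp.
move=> iab ibc.
have {}iab : (leb R).-integrable `[a, b[ (EFin \o u).
  by apply: integrableS iab => //; apply: subset_itv; rewrite bnd_simp.
apply: integrable_setU => //.
apply/disj_set2P; rewrite -subset0 => r/=; rewrite !in_itv/= => -[/andP[_ rb]].
by rewrite leNgt rb.
Qed.

Lemma continuous_itv_integrable a b u :
  {within `[a, b], continuous u} -> (leb R).-integrable `[a, b] (EFin \o u).
Proof.
by move=> cu; apply: continuous_compact_integrable => //; exact: segment_compact.
Qed.

Lemma fine_itv_measure a b : a <= b -> fine ((leb R) `[a, b[) = b - a.
Proof.
move=> ab; rewrite lebesgue_measure_itv/= lte_fin; case: ifPn => //.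
by rewrite -leNgt => ba; rewrite (@le_anti _ _ a b) ?ab ?ba// subrr.
Qed.

(** The estimate is asked on the half-open interval because the integrand will be taken along a
    state that may jump at [b]. *)
Lemma integral_itv_near a b (c e : R) u : a <= b ->
  (leb R).-integrable `[a, b] (EFin \o u) ->
  (forall r, a <= r < b -> `|u r - c| <= e) ->
  `|\int[leb R]_(r in `[a, b]) u r - c * (b - a)| <= e * (b - a).
Proof.
move=> ab iu uc.
have {}iu : (leb R).-integrable `[a, b[ (EFin \o u).
  by apply: integrableS iu => //; apply: subset_itv; rewrite bnd_simp.
have icst k : (leb R).-integrable `[a, b[ (EFin \o cst k).
  have : (leb R).-integrable `[a, b] (EFin \o cst k).
    by apply: continuous_itv_integrable => r; exact: cvg_cst.
  by apply: integrableS => //; apply: subset_itv; rewrite bnd_simp.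
rewrite -Rintegral_itv_bndo_bndc// -fine_itv_measure// -!Rintegral_cst//.
have iuc : (leb R).-integrable `[a, b[ (EFin \o (fun r => u r - c)).
  by have := integrableB _ iu (icst c); exact.
rewrite -RintegralB//; last exact: (icst c).
apply: (le_trans (le_normr_Rintegral _ _)) => //.
apply: le_Rintegral => //; first exact: integrable_norm.
exact: (icst e).
Qed.

Lemma integral_itv_norm_le a b (e : R) u : a <= b ->
  (leb R).-integrable `[a, b] (EFin \o u) ->
  (forall r, a <= r < b -> `|u r| <= e) ->
  `|\int[leb R]_(r in `[a, b]) u r| <= e * (b - a).
Proof.
move=> ab iu ue; have := @integral_itv_near a b 0 e u ab iu.
by rewrite mul0r subr0; apply=> r /ue; rewrite subr0.
Qed.

Lemma eq_integral_itv a b u v : (forall r, a <= r <= b -> u r = v r) ->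
  \int[leb R]_(r in `[a, b]) u r = \int[leb R]_(r in `[a, b]) v r.
Proof.
by move=> uv; apply: eq_Rintegral => r; rewrite inE/= in_itv/=; exact: uv.
Qed.

Lemma eq_integrable_itv a b u v : (forall r, a <= r <= b -> u r = v r) ->
  (leb R).-integrable `[a, b] (EFin \o u) ->
  (leb R).-integrable `[a, b] (EFin \o v).
Proof.
move=> uv; apply: eq_integrable => // r; rewrite inE/= in_itv/= => rab.
by rewrite uv.
Qed.

(* The value at the right endpoint, where a path may jump, is irrelevant. *)
Lemma eq_integral_itvo a b u v : a <= b ->
  (forall r, a <= r < b -> u r = v r) ->
  (leb R).-integrable `[a, b] (EFin \o u) ->
  (leb R).-integrable `[a, b] (EFin \o v) /\
  \int[leb R]_(r in `[a, b]) u r = \int[leb R]_(r in `[a, b]) v r.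
Proof.
move=> ab uv iu.
have iuo : (leb R).-integrable `[a, b[ (EFin \o u).
  by apply: integrableS iu => //; apply: subset_itv; rewrite bnd_simp.
have ivo : (leb R).-integrable `[a, b[ (EFin \o v).
  apply: eq_integrable iuo => // r; rewrite inE/= in_itv/= => rab.
  by rewrite uv.
split.
  have iv1 : (leb R).-integrable `[b, b] (EFin \o v).
    apply: continuous_itv_integrable; rewrite set_itv1.
    exact: continuous_subspace1.
  have -> : `[a, b]%classic = `[a, b[ `|` `[b, b].
    by rewrite -itv_bndbnd_setU ?bnd_simp.
  apply: integrable_setU => //; apply/disj_set2P; rewrite -subset0 => r/=.
  by rewrite !in_itv/= => -[/andP[_ rb]]; rewrite leNgt rb.
rewrite -Rintegral_itv_bndo_bndc// -[RHS]Rintegral_itv_bndo_bndc//.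
by apply: eq_Rintegral => r; rewrite inE/= in_itv/=; exact: uv.
Qed.

End IntervalIntegrals.

(** * Controlled trajectories and their cost *)

Section Paths.
Context {R : realType} {n : nat}.
Implicit Types (t s r a b : R) (x y z : 'rV[R]_n) (X Y : R -> 'rV[R]_n).
Implicit Types (xi : seq (R * 'rV[R]_n)).
Variables (T : R) (f : R -> 'rV[R]_n -> 'rV[R]_n).

Lemma within_continuous_row a b X :
  (forall i, {within `[a, b], continuous (fun r => X r 0 i)}) ->
  {within `[a, b], continuous X}.
Proof.
move=> cX; apply/subspace_continuousP => r rab; apply/cvgrPdist_le => e e0.
near=> q; apply: norm_rV_le; first exact: ltW.
near: q; apply: filter_forall => i.
have /subspace_continuousP/(_ _ rab)/cvgrPdist_le/(_ _ e0) := cX i.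
by apply: filterS => q; rewrite !mxE.
Unshelve. all: by end_near. Qed.

(** The integral part of the state equation as an operator on paths: it is the Picard map, and along
    a controlled path without earlier impulses its value at [r] is the state just before the
    impulses at [r]. *)
Definition drift_path t x X r : 'rV[R]_n :=
  x + \row_i (\int[leb R]_(q in `[t, r]) f q (X q) 0 i).

Definition drift_integrable X a b :=
  forall i, (leb R).-integrable `[a, b] (EFin \o (fun r => f r (X r) 0 i)).

Lemma drift_path_start t x X : drift_path t x X t = x.
Proof.
rewrite /drift_path set_itv1 -[RHS]addr0; congr (_ + _).
by apply/rowP => i; rewrite !mxE Rintegral_set1.
Qed.

Lemma drift_path_continuous t b x X : t <= b -> drift_integrable X t b ->
  {within `[t, b], continuous (drift_path t x X)}.
Proof.
move=> tb iX; apply: within_continuous_row => i.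
have := parameterized_integral_continuous tb (iX i).
move=> /subspace_continuousP cI; apply/subspace_continuousP => r rab.
have -> : (fun r => drift_path t x X r 0 i) = (fun r => x 0 i +
    \int[leb R]_(q in `[t, r]) f q (X q) 0 i) by apply/funext => q; rewrite !mxE.
by apply: cvgD; [exact: cvg_cst|exact: cI].
Qed.

Lemma drift_path_shift t s r x X : t <= s -> s <= r -> drift_integrable X t r ->
  drift_path t x X r = drift_path s (drift_path t x X s) X r.
Proof.
move=> ts sr iX; rewrite /drift_path -addrA; congr (_ + _).
by apply/rowP => i; rewrite !mxE (integral_itv_split ts sr).
Qed.

Lemma drift_path_addl t x z X r :
  drift_path t (x + z) X r = z + drift_path t x X r.
Proof. by rewrite /drift_path addrAC addrC. Qed.

Lemma eq_drift_path t r x X Y : (forall q, t <= q <= r -> X q = Y q) ->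
  drift_path t x X r = drift_path t x Y r.
Proof.
move=> XY; congr (_ + _); apply/rowP => i; rewrite !mxE.
by apply: eq_integral_itv => q /XY ->.
Qed.

Lemma eq_drift_integrable a b X Y : (forall q, a <= q <= b -> X q = Y q) ->
  drift_integrable X a b -> drift_integrable Y a b.
Proof.
move=> XY iX i; apply: eq_integrable_itv (iX i) => q qab.
by rewrite XY.
Qed.

Lemma eq_drift_path_left t s x X Y : t <= s ->
  (forall q, t <= q < s -> X q = Y q) -> drift_integrable X t s ->
  drift_integrable Y t s /\ drift_path t x X s = drift_path t x Y s.
Proof.
move=> ts XY iX.
have key i : (leb R).-integrable `[t, s] (EFin \o (fun r => f r (Y r) 0 i)) /\
    \int[leb R]_(r in `[t, s]) f r (X r) 0 i =
    \int[leb R]_(r in `[t, s]) f r (Y r) 0 i.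
  by apply: eq_integral_itvo (iX i) => // r /XY ->.
split=> [i|]; first by have [] := key i.
by congr (_ + _); apply/rowP => i; rewrite !mxE; have [_ ->] := key i.
Qed.

Lemma drift_path_cvg_left t s x X : t < s -> drift_integrable X t s ->
  drift_path t x X r @[r --> s^'-] --> drift_path t x X s.
Proof.
move=> ts iX; have := drift_path_continuous (x := x) (ltW ts) iX.
by move=> /(continuous_within_itvP _ ts)[].
Qed.

Lemma impulse_path_cons (p : R * 'rV[R]_n) xi r :
  impulse_path (p :: xi) r = (if p.1 <= r then p.2 else 0) + impulse_path xi r.
Proof. by rewrite /impulse_path big_cons; case: ifP => // _; rewrite add0r. Qed.

Lemma impulse_path_before xi s r : (forall p, p \in xi -> s <= p.1) -> r < s ->
  impulse_path xi r = 0.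
Proof.
move=> xis rs; rewrite /impulse_path big_seq_cond big_pred0// => p.
by apply/negP => /andP[/xis sp pr]; move: (lt_le_trans rs sp); rewrite ltNge pr.
Qed.

Lemma impulse_path_bounded xi : exists B, forall r, `|impulse_path xi r| <= B.
Proof.
exists (\sum_(p <- xi) `|p.2|) => r; rewrite /impulse_path.
apply: (le_trans (ler_norm_sum _ _ _)); rewrite [leRHS](bigID (fun p => p.1 <= r))/=.
by rewrite lerDl; exact: sumr_ge0.
Qed.

Lemma trajectoryP t x xi X : trajectory T f t x xi X <->
  drift_integrable X t T /\
  (forall s, t <= s <= T -> X s = drift_path t x X s + impulse_path xi s).
Proof. by []. Qed.

(** On either side of its time, the first impulse is a constant that can be absorbed into the
    continuous part; hence the induction on [xi] with [Y] arbitrary. *)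
Lemma path_comp_measurable (F : R -> 'rV[R]_n -> R) a b Y xi :
  {within slab T, continuous (fun p => F p.1 p.2)} -> 0 <= a -> b <= T ->
  {within `[a, b], continuous Y} ->
  measurable_fun `[a, b] (fun r => F r (Y r + impulse_path xi r)).
Proof.
move=> cF a0 bT; elim: xi Y => [|p xi IH] Y cY.
  apply: subspace_continuous_measurable_fun => //.
  have -> : (fun r => F r (Y r + impulse_path [::] r)) = (fun r => F r (Y r)).
    by apply/funext => r; rewrite /impulse_path big_nil addr0.
  exact: slab_continuous_path cF a0 bT cY.
have -> : (fun r => F r (Y r + impulse_path (p :: xi) r)) =
  (fun r => if p.1 <= r then F r ((Y r + p.2) + impulse_path xi r)
            else F r (Y r + impulse_path xi r)).
  apply/funext => r; rewrite impulse_path_cons.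
  by case: ifP => _; rewrite ?add0r ?addrA.
apply: measurable_fun_if => //.
- exact: measurable_fun_ler.
- apply: (measurable_funS (E := `[a, b]%classic)) => //.
  apply: IH => r; apply: cvgD; [exact: cY|exact: cvg_cst].
- by apply: (measurable_funS (E := `[a, b]%classic)) => //; exact: IH.
Qed.

Lemma trajectory_bounded t x xi X : t <= T -> trajectory T f t x xi X ->
  exists B, forall r, t <= r <= T -> `|X r| <= B.
Proof.
move=> tT /trajectoryP[iX eX].
have /continuous_compact/(_ (@segment_compact _ _ _)) :=
  drift_path_continuous (x := x) tT iX.
move=> /compact_bounded[M [_ MP]]; have [B BP] := impulse_path_bounded xi.
exists (M + 1 + B) => r rt; rewrite eX//.
apply: (le_trans (ler_normD _ _)); apply: lerD; last exact: BP.
by apply: (MP (M + 1)); [rewrite ltrDl|exists r; rewrite ?in_itv].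
Qed.

End Paths.

(** * Cutting, splicing and prepending for trajectories and costs *)

Section Costs.
Context {R : realType} {n : nat}.
Implicit Types (t s r : R) (x y z : 'rV[R]_n) (X Y : R -> 'rV[R]_n).
Implicit Types (xi : seq (R * 'rV[R]_n)).
Variables (T : R) (f : R -> 'rV[R]_n -> 'rV[R]_n).

Lemma trajectory_before t s x xi X : s <= T -> (forall p, p \in xi -> s <= p.1) ->
  trajectory T f t x xi X -> forall r, t <= r < s -> X r = drift_path f t x X r.
Proof.
move=> sT xis /trajectoryP[_ eX] r /andP[tr rs].
by rewrite eX ?tr ?(le_trans (ltW rs))// (impulse_path_before xis) ?addr0.
Qed.

(** Impulses at [s] itself are invisible to the left limit. This evaluates the [lim] in
    [pre_impulse_state]. *)
Lemma trajectory_cvg_left t s x xi X : t < s -> s <= T ->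
  (forall p, p \in xi -> s <= p.1) -> trajectory T f t x xi X ->
  X r @[r --> s^'-] --> drift_path f t x X s.
Proof.
move=> ts sT xis tX; have /trajectoryP[iX _] := tX.
have iXs : drift_integrable f X t s.
  by move=> i; apply: integrable_itvS (iX i).
have := drift_path_cvg_left (x := x) ts iXs.
apply: cvg_trans; apply: near_eq_cvg; near=> r.
rewrite (trajectory_before sT xis tX)//; apply/andP; split.
  by near: r; exact: nbhs_left_ge.
by near: r; exact: nbhs_left_lt.
Unshelve. all: by end_near. Qed.

(** The restart point is not [X s]: the list [xi] is kept whole, so its impulses up to [s] are
    counted again by [impulse_path] from [s] on. *)
Lemma trajectory_split t s x xi X : t <= s -> s <= T ->
  trajectory T f t x xi X ->
  trajectory T f s (drift_path f t x X s) xi X.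
Proof.
move=> ts sT /trajectoryP[iX eX]; apply/trajectoryP; split.
  by move=> i; apply: integrable_itvS (iX i).
move=> r /andP[sr rT]; rewrite eX ?rT ?(le_trans ts)//.
rewrite (drift_path_shift _ ts sr)// => i.
by apply: integrable_itvS (iX i).
Qed.

(** The test [r < s] is strict because [X2 s] already contains the impulses made at [s], while
    [X1 s] is the state before them. *)
Lemma trajectory_cat t s x xi X1 X2 : t <= s -> s <= T ->
  (forall p, p \in xi -> s <= p.1) ->
  drift_integrable f X1 t s ->
  (forall r, t <= r <= s -> X1 r = drift_path f t x X1 r) ->
  trajectory T f s (X1 s) xi X2 ->
  trajectory T f t x xi (fun r => if r < s then X1 r else X2 r).
Proof.
move=> ts sT xis i1 e1 /trajectoryP[i2 e2]; set X := fun r => _.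
have X1E r : t <= r < s -> X1 r = X r by move=> /andP[_ rs]; rewrite /X rs.
have X2E r : s <= r <= T -> X2 r = X r.
  by move=> /andP[sr _]; rewrite /X ltNge sr.
have [iX1 ds] := eq_drift_path_left x ts X1E i1.
rewrite -e1 ?lexx ?ts// in ds.
have iX2 : drift_integrable f X s T by exact: eq_drift_integrable i2.
have iX : drift_integrable f X t T.
  by move=> i; exact: integrable_itv_cat ts sT (iX1 i) (iX2 i).
apply/trajectoryP; split=> // r /andP[tr rT].
have [rs|sr] := ltP r s.
  rewrite {1}/X rs (impulse_path_before xis rs) addr0 e1 ?tr ?(ltW rs)//.
  apply: eq_drift_path => q /andP[tq qr].
  by rewrite /X (le_lt_trans qr rs).
rewrite (drift_path_shift _ ts sr); last first.
  by move=> i; apply: integrable_itvS (iX i).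
rewrite {1}/X ltNge sr/= -ds e2 ?sr//; congr (_ + _).
apply: eq_drift_path => q /andP[sq qr]; apply: X2E.
by rewrite sq (le_trans qr).
Qed.

(** An impulse at the initial time is active on all of [[t, T]], like a shift of the initial state;
    the path [X] is the same on both sides. *)
Lemma trajectory_prepend t x z xi X :
  trajectory T f t x ((t, z) :: xi) X <-> trajectory T f t (x + z) xi X.
Proof.
split=> /trajectoryP[iX eX]; apply/trajectoryP; split=> // r rt.
  rewrite (eX r rt) impulse_path_cons/= (andP rt).1 drift_path_addl addrA.
  by rewrite [z + _]addrC.
rewrite (eX r rt) impulse_path_cons/= (andP rt).1 drift_path_addl [RHS]addrA.
by rewrite [z + _]addrC.
Qed.

Variables (g : R -> 'rV[R]_n -> R) (h : 'rV[R]_n -> R).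
Variable l : R -> 'rV[R]_n -> 'rV[R]_n -> R.

Lemma eq_cost s y xi X Y : s <= T -> (forall p, p \in xi -> s <= p.1 <= T) ->
  (forall r, s <= r <= T -> X r = Y r) ->
  cost T g h l s y xi X = cost T g h l s y xi Y.
Proof.
move=> sT xis XY; congr (_ + _ + _).
- by apply: eq_integral_itv => r /XY ->.
- by rewrite XY// sT lexx.
(* At an impulse time after [s] the left limit only involves times in [[s, T]]; at [s] itself no
   limit is taken. *)
- apply: eq_bigr => k _; congr l; congr (_ + _); case: ifPn => // ks.
  have /xis/andP[sk kT] := mem_nth (0, 0) (ltn_ord k).
  have {}ks : s < (nth (0, 0) xi k).1 by rewrite lt_neqAle eq_sym ks.
  have XYn : \forall r \near (nth (0, 0) xi k).1^'-, X r = Y r.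
    near=> r; apply: XY; apply/andP; split.
      by near: r; exact: nbhs_left_ge.
    by rewrite (le_trans _ kT)// ltW//; near: r; exact: nbhs_left_lt.
  congr lim; apply/seteqP; split; apply: near_eq_cvg => //.
  by apply: filterS XYn => r /esym.
Unshelve. all: by end_near. Qed.

(** For an impulse at [s > t], the left limit seen from [t] is the initial state seen from [s], by
    [trajectory_cvg_left]. At later times both sides use the same left limit. *)
Lemma pre_impulse_state_split t s x xi X k : t <= s -> s <= T ->
  (forall p, p \in xi -> s <= p.1) -> (k < size xi)%N ->
  trajectory T f t x xi X ->
  pre_impulse_state t x xi X k =
  pre_impulse_state s (drift_path f t x X s) xi X k.
Proof.
move=> ts sT xis kx tX; rewrite /pre_impulse_state; congr (_ + _).
have sk : s <= (nth (0, 0) xi k).1 by apply: xis; exact: mem_nth.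
have [ks|ks] := eqVneq (nth (0, 0) xi k).1 s.
  rewrite ks; have [->|st] := eqVneq s t; first by rewrite drift_path_start.
  apply: cvg_lim => //; apply: trajectory_cvg_left tX => //.
  by rewrite lt_neqAle eq_sym st.
rewrite ifF//; apply/negbTE; apply: contra_neq ks => kt.
by apply/le_anti; rewrite sk kt ts.
Qed.

Lemma pre_impulse_state_prepend0 t x z xi X :
  pre_impulse_state t x ((t, z) :: xi) X 0 = x.
Proof. by rewrite /pre_impulse_state/= eqxx big_ord0 addr0. Qed.

(** For an impulse also made at [t], the summand [z] moves from the sum of preceding impulses to the
    initial state; at later times it is already in the left limit. *)
Lemma pre_impulse_state_prepend t x z xi X k :
  pre_impulse_state t x ((t, z) :: xi) X k.+1 =
  pre_impulse_state t (x + z) xi X k.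
Proof.
rewrite /pre_impulse_state/= big_mkcond big_ord_recl/= [in RHS]big_mkcond/=.
rewrite [t == _]eq_sym; case: ifP => _; first by rewrite addrA.
by rewrite add0r.
Qed.

Lemma cost_prepend t x z xi X :
  cost T g h l t x ((t, z) :: xi) X =
  l t x z + cost T g h l t (x + z) xi X.
Proof.
rewrite /cost/= big_ord_recl/= pre_impulse_state_prepend0 addrCA.
by congr (_ + (_ + _)); apply: eq_bigr => k _; rewrite pre_impulse_state_prepend.
Qed.

Lemma running_cost_integrable L mu delta t x xi X : 0 <= t -> t <= T ->
  0 < L -> 0 < mu -> 0 < delta ->
  running_cost_condition T L mu delta g -> trajectory T f t x xi X ->
  (leb R).-integrable `[t, T] (EFin \o (fun r => g r (X r))).
Proof.
move=> t0 tT L0 mu0 d0 [cg gb _] tX.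
have [B XB] := trajectory_bounded tT tX.
have /trajectoryP[iX eX] := tX.
apply: measurable_bounded_integrable => //.
- by rewrite /= lebesgue_measure_itv/= lte_fin; case: ifPn => //; rewrite ltry.
- have : measurable_fun `[t, T] (fun r => g r (drift_path f t x X r + impulse_path xi r)).
    apply: (path_comp_measurable _ cg) => //.
    exact: drift_path_continuous.
  apply: eq_measurable_fun => r; rewrite inE/= in_itv/= => rt.
  by rewrite -eX.
- exists (L * (1 + (n%:R * B) `^ (mu + delta))); split; first exact: num_real.
  move=> M LM r /=; rewrite in_itv/= => rt; have /andP[tr rT] := rt.
  have rT0 : 0 <= r <= T by rewrite (le_trans t0).
  have /andP[g0 gL] := gb r (X r) rT0.
  rewrite ger0_norm// (le_trans gL)// (le_trans _ (ltW LM))//.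
  rewrite ler_pM2l// lerD2l ge0_ler_powR ?nnegrE ?sqrtr_ge0//.
  + by rewrite ltW// addr_gt0.
  + by rewrite mulr_ge0// (le_trans _ (XB _ rt)).
  + by rewrite (le_trans (enorm_le_norm _))// ler_wpM2l// XB.
Qed.

Lemma cost_split t s x xi X : t <= s -> s <= T ->
  (forall p, p \in xi -> s <= p.1) -> trajectory T f t x xi X ->
  (leb R).-integrable `[t, T] (EFin \o (fun r => g r (X r))) ->
  cost T g h l t x xi X = \int[leb R]_(r in `[t, s]) g r (X r) +
    cost T g h l s (drift_path f t x X s) xi X.
Proof.
move=> ts sT xis tX ig; rewrite /cost (integral_itv_split ts sT)// !addrA.
by congr (_ + _); apply: eq_bigr => k _; rewrite (pre_impulse_state_split ts sT).
Qed.

End Costs.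

(** * The state equation *)

Lemma half_pow_small {R : realType} (c e : R) : 0 < e ->
  exists k, c * 2^-1 ^+ k < e.
Proof.
move=> e0; have : (c * 2^-1 ^+ k) @[k --> \oo] --> c * 0.
  by apply: cvgMr; apply: cvg_expr; rewrite ger0_norm// invf_lt1// ltr1n.
rewrite mulr0 => /cvgrPdist_lt/(_ _ e0)[k _ /(_ k (leqnn k))]/=.
by rewrite sub0r normrN => /(le_lt_trans (ler_norm _)); exists k.
Qed.

Lemma le_half_pow {R : realType} (a b c : R) :
  (forall k, a <= b + c * 2^-1 ^+ k) -> a <= b.
Proof.
move=> abc; apply/ler_addgt0Pr => e e0; have [k ck] := half_pow_small c e0.
by rewrite (le_trans (abc k))// lerD2l ltW.
Qed.

Section Drift.
Context {R : realType} {n : nat}.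
Implicit Types (t s r : R) (x y z : 'rV[R]_n) (X Y : R -> 'rV[R]_n).
Variables (T Lf : R) (f : R -> 'rV[R]_n -> 'rV[R]_n).
Hypotheses (Lf0 : 0 < Lf) (cond_f : drift_condition T Lf f).

(* A Lipschitz and growth constant of [f] for the sup norm. *)
Definition sup_lip : R := Lf * (n%:R + 1).
Let C := sup_lip.

Lemma sup_lip_gt0 : 0 < C.
Proof. by rewrite /C /sup_lip mulr_gt0// ltr_wpDl. Qed.

Lemma drift_lipschitz t y z : 0 <= t <= T -> `|f t y - f t z| <= C * `|y - z|.
Proof.
move=> tT; have [_ lf _] := cond_f.
rewrite (le_trans (norm_le_enorm _))// (le_trans (lf _ _ _ tT))//.
rewrite /C /sup_lip -mulrA ler_pM2l// (le_trans (enorm_le_norm _))//.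
by rewrite mulrDl mul1r lerDl.
Qed.

Lemma drift_growth t y : 0 <= t <= T -> `|f t y| <= C * (1 + `|y|).
Proof.
move=> tT; have [_ lf f0] := cond_f.
rewrite -[f t y](subrK (f t 0)) (le_trans (ler_normD _ _))//.
rewrite mulrDr mulr1 addrC lerD//.
  rewrite (le_trans (norm_le_enorm _))// (le_trans (f0 _ tT))//.
  by rewrite /C /sup_lip ler_peMr ?(ltW Lf0)// lerDr.
by rewrite (le_trans (drift_lipschitz _ _ tT))// subr0.
Qed.

Lemma continuous_drift_integrable t s X : 0 <= t -> s <= T ->
  {within `[t, s], continuous X} -> drift_integrable f X t s.
Proof.
move=> t0 sT cX i; apply: continuous_itv_integrable.
have [cf _ _] := cond_f; have := slab_continuous_path cf t0 sT cX.
move=> /subspace_continuousP cfX; apply/subspace_continuousP => r rts.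
apply/cvgrPdist_lt => e e0; have /cvgrPdist_lt/(_ _ e0) := cfX _ rts.
apply: filterS => q; apply: le_lt_trans.
by have := coord_le_norm (f r (X r) - f q (X q)) i; rewrite !mxE.
Qed.

Lemma drift_path_dist t s x X Y e : 0 <= t -> t <= s -> s <= T ->
  drift_integrable f X t s -> drift_integrable f Y t s -> 0 <= e ->
  (forall q, t <= q < s -> `|X q - Y q| <= e) ->
  `|drift_path f t x X s - drift_path f t x Y s| <= C * (s - t) * e.
Proof.
move=> t0 ts sT iX iY e0 XY.
rewrite /drift_path opprD addrACA subrr add0r.
apply: norm_rV_le => [|i].
  by rewrite mulr_ge0// mulr_ge0 ?subr_ge0// ltW// sup_lip_gt0.
rewrite !mxE -RintegralB// mulrAC.
apply: integral_itv_norm_le => //.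
  by have := integrableB _ (iX i) (iY i); exact.
move=> q /[dup] tqs /andP[tq qs].
have qT : 0 <= q <= T by rewrite (le_trans t0)//= (le_trans (ltW qs)).
have := coord_le_norm (f q (X q) - f q (Y q)) i; rewrite !mxE => /le_trans; apply.
rewrite (le_trans (drift_lipschitz _ _ qT))// ler_pM2l ?XY//.
exact: sup_lip_gt0.
Qed.

Lemma drift_path_growth t s x X B : 0 <= t -> t <= s -> s <= T ->
  drift_integrable f X t s -> 0 <= B ->
  (forall q, t <= q < s -> `|X q| <= B) ->
  `|drift_path f t x X s - x| <= C * (s - t) * (1 + B).
Proof.
move=> t0 ts sT iX B0 XB; rewrite /drift_path addrAC subrr add0r.
apply: norm_rV_le => [|i].
  rewrite mulr_ge0 ?addr_ge0// mulr_ge0 ?subr_ge0// ltW//; exact: sup_lip_gt0.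
rewrite !mxE mulrAC; apply: integral_itv_norm_le => //.
move=> q /[dup] tqs /andP[tq qs].
have qT : 0 <= q <= T by rewrite (le_trans t0)//= (le_trans (ltW qs)).
rewrite (le_trans (coord_le_norm _ _))// (le_trans (drift_growth _ qT))//.
by rewrite ler_pM2l ?sup_lip_gt0// lerD2l XB.
Qed.

(* A bound [B] for [|X - x|] improves to [A + B / 2]; iterate. *)
Lemma short_time_bound t s x X : 0 <= t -> t <= s -> s <= T ->
  C * (s - t) <= 2^-1 -> drift_integrable f X t s ->
  (forall r, t <= r < s -> X r = drift_path f t x X r) ->
  let A := 2 * (C * (s - t) * (1 + `|x|)) in
  (forall r, t <= r < s -> `|X r - x| <= A) /\ `|drift_path f t x X s - x| <= A.
Proof.
move=> t0 ts sT small iX eX A.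
have C0 := sup_lip_gt0.
have A0 : 0 <= C * (s - t) * (1 + `|x|).
  by rewrite mulr_ge0 ?addr_ge0// mulr_ge0 ?subr_ge0// ltW.
have iXr r : t <= r <= s -> drift_integrable f X t r.
  by move=> /andP[tr rs] i; apply: integrable_itvS (iX i).
have improve B r : 0 <= B -> (forall q, t <= q < s -> `|X q - x| <= B) ->
    t <= r <= s -> `|drift_path f t x X r - x| <= A / 2 + B / 2.
  move=> B0 XB /[dup] trs /andP[tr rs].
  have : forall q, t <= q < r -> `|X q| <= `|x| + B.
    move=> q /andP[tq qr]; rewrite -[X q](subrK x) addrC.
    by rewrite (le_trans (ler_normD _ _))// lerD2l XB// tq (lt_le_trans qr).
  move=> /(drift_path_growth x t0 tr (le_trans rs sT) (iXr r trs)
    (addr_ge0 (normr_ge0 _) B0)) /le_trans; apply.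
  apply: (@le_trans _ _ (C * (s - t) * (1 + (`|x| + B)))).
    by rewrite ler_wpM2r ?addr_ge0// ler_pM2l// lerD2r.
  have -> : A / 2 = C * (s - t) * (1 + `|x|) by rewrite /A mulrC mulKf.
  by rewrite addrA mulrDr lerD2l [leRHS]mulrC ler_wpM2r.
(* The iteration needs a finite start: the drift part is continuous on a compact segment, and before
   [s] it is the state. *)
have [M [Mr MP]] := compact_bounded (continuous_compact
  (drift_path_continuous (x := x) ts iX) (@segment_compact _ _ _)).
pose B := `|M| + 1 + `|x|.
have B0 : 0 <= B by rewrite !addr_ge0.
(* [A] is the fixed point of the map sending [B] to [A / 2 + B / 2], so each round halves the excess
   over [A]. *)
have XB k r : t <= r < s -> `|X r - x| <= A + B * 2^-1 ^+ k.
  elim: k r => [|k IH] r /[dup] trs /andP[tr rs].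
    rewrite expr0 mulr1 (le_trans (ler_normB _ _))// eX//.
    apply: ler_wpDl; first by rewrite mulr_ge0.
    rewrite lerD2r; apply: (MP (`|M| + 1)).
      by rewrite (le_lt_trans (ler_norm _))// ltrDl.
    by exists r => //=; rewrite in_itv/= tr ltW.
  have B1 : 0 <= A + B * 2^-1 ^+ k.
    by rewrite addr_ge0// mulr_ge0// exprn_ge0.
  rewrite eX// (le_trans (improve _ _ B1 IH _))//; first by rewrite tr ltW.
  by rewrite exprSr mulrA mulrDl addrA -splitr.
have XA r : t <= r < s -> `|X r - x| <= A.
  by move=> rs; apply: (@le_half_pow _ _ _ B) => k; exact: XB.
split=> //; rewrite (le_trans (improve A s _ XA _))//.
- by rewrite mulr_ge0.
- by rewrite ts lexx.
- by rewrite -splitr.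
Qed.

End Drift.

(** * Local existence for the impulse-free state equation *)

Section Picard.
Context {R : realType} {n : nat}.
Variables (T Lf : R) (f : R -> 'rV[R]_n -> 'rV[R]_n).
Hypotheses (Lf0 : 0 < Lf) (cond_f : drift_condition T Lf f).
Variables (t s : R) (x : 'rV[R]_n).
Hypotheses (t0 : 0 <= t) (ts : t <= s) (sT : s <= T).
Hypothesis small : sup_lip (n := n) Lf * (s - t) <= 2^-1.

Let P k := iter k (drift_path f t x) (cst x).

Let P_continuous k : {within `[t, s], continuous (P k)}.
Proof.
elim: k => [|k IH]; first by move=> r; exact: cvg_cst.
apply: drift_path_continuous => //.
exact: (continuous_drift_integrable cond_f t0 sT IH).
Qed.

Let P_integrable k r : r <= s -> drift_integrable f (P k) t r.
Proof.
move=> rs i; apply: integrable_itvS (lexx t) rs _.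
exact: (continuous_drift_integrable cond_f t0 sT (@P_continuous k)).
Qed.

Let contract X Y e r : t <= r <= s -> 0 <= e ->
  drift_integrable f X t r -> drift_integrable f Y t r ->
  (forall q, t <= q < r -> `|X q - Y q| <= e) ->
  `|drift_path f t x X r - drift_path f t x Y r| <= 2^-1 * e.
Proof.
move=> /andP[tr rs] e0 iX iY XY.
have := drift_path_dist Lf0 cond_f x t0 tr (le_trans rs sT) iX iY e0 XY.
move=> /le_trans; apply.
rewrite ler_wpM2r// (le_trans _ small)// ler_pM2l ?lerD2r//.
exact: sup_lip_gt0.
Qed.

Let B := sup_lip (n := n) Lf * (s - t) * (1 + `|x|).

Let B0 : 0 <= B.
Proof.
by rewrite mulr_ge0 ?addr_ge0// mulr_ge0 ?subr_ge0// ltW// sup_lip_gt0.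
Qed.

Let P_step k r : t <= r <= s -> `|P k.+1 r - P k r| <= B * 2^-1 ^+ k.
Proof.
elim: k r => [|k IH] r /[dup] trs /andP[tr rs].
  rewrite expr0 mulr1.
  apply: (le_trans (drift_path_growth Lf0 cond_f x t0 tr (le_trans rs sT)
    (P_integrable 0 rs) (normr_ge0 x) _)) => //.
  rewrite /B ler_wpM2r ?addr_ge0// ler_pM2l ?lerD2r//.
  exact: sup_lip_gt0.
rewrite exprS mulrCA; apply: (@contract (P k.+1) (P k)) => //.
- by rewrite mulr_ge0// exprn_ge0.
- exact: (@P_integrable k.+1).
- exact: (@P_integrable k).
- by move=> q /andP[tq qr]; apply: IH; rewrite tq ltW// (lt_le_trans qr).
Qed.

Let P_dist k m r : t <= r <= s -> `|P (k + m) r - P k r| <= 2 * B * 2^-1 ^+ k.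
Proof.
(* The exact partial geometric sum, in place of its limit, makes the induction on [m] close. *)
move=> rs; apply: (@le_trans _ _ (2 * B * 2^-1 ^+ k * (1 - 2^-1 ^+ m))).
  elim: m => [|m IH]; first by rewrite addn0 subrr normr0 expr0 subrr mulr0.
  rewrite -[P _ r](subrK (P (k + m) r)) -addrA addnS.
  rewrite (le_trans (ler_normD _ _))// (le_trans (lerD (P_step _ rs) IH))//.
  rewrite exprD exprS le_eqVlt; apply/orP; left; apply/eqP.
  by field.
have pow0 j : 0 <= (2^-1 : R) ^+ j by rewrite exprn_ge0.
by rewrite ler_piMr ?gerBl ?pow0// mulr_ge0 ?pow0// mulr_ge0.
Qed.

Let P_cvg r : t <= r <= s -> cvg (P k r @[k --> \oo]).
Proof.
move=> rs; apply/cauchy_cvgP/cauchy_exP => e e0.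
have [k ke] := half_pow_small (2 * B) e0.
exists (P k r); exists k => // m /= km; rewrite -ball_normE /= distrC.
by apply: le_lt_trans ke; rewrite -(subnKC km); exact: P_dist.
Qed.

Let X r := lim (P k r @[k --> \oo]).

Let X_dist k r : t <= r <= s -> `|X r - P k r| <= 2 * B * 2^-1 ^+ k.
Proof.
move=> rs; apply/ler_addgt0Pr => e e0.
have /cvgrPdist_lt/(_ _ e0)[N _ NP] := P_cvg rs.
have /ltW XN := NP (k + N)%N (leq_addl _ _).
apply: le_trans (ler_distD (P (k + N) r) _ _) _.
by rewrite addrC lerD//; exact: P_dist.
Qed.

Let X_continuous : {within `[t, s], continuous X}.
Proof.
apply/subspace_continuousP => r rts; apply/cvgrPdist_lt => e e0.
have e3 : 0 < e / 3 by rewrite divr_gt0.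
have [k ke] := half_pow_small (2 * B) e3.
have /subspace_continuousP/(_ _ rts)/cvgrPdist_lt/(_ _ e3) := @P_continuous k.
rewrite !near_withinE; apply: filterS => q /[swap] qts /(_ qts) rq.
move: (rts) (qts); rewrite /= !in_itv/= => /(X_dist k) Xr /(X_dist k) Xq.
have := ler_distD (P k q) (X r) (X q); have := ler_distD (P k r) (X r) (P k q).
by move: Xr Xq; rewrite [`|X q - _|]distrC; lra.
Qed.

(** By [small], [drift_path] contracts sup distances by one half. Its iterates from the constant
    path converge uniformly, so the limit is continuous and the drift along it integrable. *)
Lemma picard : exists Y : R -> 'rV[R]_n, [/\ {within `[t, s], continuous Y},
  drift_integrable f Y t s &
  forall r, t <= r <= s -> Y r = drift_path f t x Y r].
Proof.
have iX := continuous_drift_integrable cond_f t0 sT X_continuous.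
exists X; split=> // r /[dup] trs /andP[tr rs].
apply/eqP; rewrite -subr_eq0 -normr_le0.
(* [X] and its image under [drift_path] are compared through [P k.+1]; each of the two distances is
   at most half of [2 * B * 2^-1 ^+ k]. *)
apply: (@le_half_pow _ _ _ (2 * B)) => k; rewrite add0r.
apply: le_trans (ler_distD (P k.+1 r) _ _) _.
have iXr : drift_integrable f X t r.
  by move=> i; exact: integrable_itvS (lexx t) rs (iX i).
have e0 : 0 <= 2 * B * 2^-1 ^+ k.
  by apply: mulr_ge0; [apply: mulr_ge0|apply: exprn_ge0].
have /= := contract trs e0 (@P_integrable k r rs) iXr.
move=> PX; have {}PX : `|P k.+1 r - drift_path f t x X r| <= 2^-1 * (2 * B * 2^-1 ^+ k).
  apply: PX => q /andP[tq qr]; rewrite distrC X_dist// tq ltW//.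
  exact: lt_le_trans qr rs.
have := X_dist k.+1 trs; rewrite exprS; move: PX; lra.
Qed.

End Picard.

(** * First-order expansion of the value function *)

Section Expansion.
Context {R : realType} {n : nat}.
Implicit Types (t s r : R) (x y z : 'rV[R]_n) (X Y : R -> 'rV[R]_n).
Variables (T : R) (V : R -> 'rV[R]_n -> R).
Hypothesis C1V : C1_slab T V.

(** At an interior time, increments smaller than [t] and [T - t] stay in [[0, T]], so the relative
    derivative is the ordinary one required by the mean value theorem. *)
Lemma time_is_derive t x : 0 < t < T ->
  is_derive t 1 (V ^~ x) (time_derivative T V t x).
Proof.
move=> /andP[t0 tT]; have [dV _ _ _ _] := C1V.
have tT' : 0 <= t <= T by rewrite !ltW.
have /cvgrPdist_lt cV := dV t x tT'.
have {}cV : h^-1 *: ((V ^~ x \o shift t) (h *: 1) - V t x) @[h --> 0^'] -->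
    time_derivative T V t x.
  apply/cvgrPdist_lt => e e0; move: (cV _ e0); rewrite near_withinE.
  rewrite !near_withinE => /nbhs_ballP[d /= d0 dP].
  have d'0 : 0 < Num.min d (Num.min t (T - t)) by rewrite !lt_min d0 t0 subr_gt0.
  apply/nbhs_ballP; exists (Num.min d (Num.min t (T - t))) => //= h.
  rewrite -ball_normE/= sub0r normrN !lt_min => /and3P[hd ht hT] h0.
  have := dP (h + t); rewrite -ball_normE/= opprD addrCA subrr addr0 normrN.
  rewrite /time_quotient addrK scaler1; apply => //.
    by apply: contra_neq h0 => /eqP; rewrite -subr_eq0 addrK => /eqP.
  move: ht hT; rewrite !ltr_norml in_itv/= => /andP[a1 a2] /andP[b1 b2].
  by apply/andP; split; lra.
by split; [exact: cvgP cV|exact: cvg_lim cV].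
Qed.

Lemma partial_is_derive t x (i : 'I_n) (u : R) : 0 <= t <= T ->
  is_derive u 1 (fun u => V t (x + u *: delta_mx 0 i))
    (space_gradient V t (x + u *: delta_mx 0 i) 0 i).
Proof.
move=> tT; have [_ /(_ _ (x + u *: delta_mx 0 i) i tT) dV _ _ _] := C1V.
have E : (fun h => h^-1 *: (((fun u => V t (x + u *: delta_mx 0 i)) \o shift u)
      (h *: 1) - V t (x + u *: delta_mx 0 i))) =
    (fun h => h^-1 *: ((V t \o shift (x + u *: delta_mx 0 i))
      (h *: delta_mx 0 i) - V t (x + u *: delta_mx 0 i))).
  apply/funext => h /=; congr (_ *: (V t _ - _)).
  by rewrite scaler1 scalerDl addrCA.
split; first by rewrite /derivable E.
by rewrite /derive E mxE.
Qed.

(** The order of [a] and [b] is left open because a coordinate increment may have either sign. *)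
Lemma MVT_between (u du : R -> R) (a b : R) : (forall c : R, is_derive c 1 u (du c)) ->
  exists2 c : R, `|c - a| <= `|b - a| & u b - u a = du c * (b - a).
Proof.
move=> du'; have cu p q : {within `[p, q], continuous u}.
  by apply: derivable_within_continuous => c _; have [] := du' c.
have [ab|/ltW ba] := leP a b.
  have [c cab ->] := MVT_segment ab (fun c _ => du' c) (cu a b).
  exists c => //; move: cab; rewrite in_itv/= => /andP[ac cb].
  by rewrite !ger0_norm ?subr_ge0// lerD2r.
have [c cab E] := MVT_segment ba (fun c _ => du' c) (cu b a).
exists c; last by rewrite -[LHS]opprB E -mulrN opprB.
move: cab; rewrite in_itv/= => /andP[ac cb].
by rewrite !ler0_norm ?subr_le0// lerN2 lerD2r.
Qed.

Let mix x y (k : nat) : 'rV[R]_n := \row_j (if (j < k)%N then y 0 j else x 0 j).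

(** The points [mix x y k] lead from [x] to [y] by changing one coordinate at a time; the increment
    telescopes along them and each step needs one partial derivative. *)
Lemma space_increment t x y (p : 'rV[R]_n) e : 0 <= t <= T -> 0 <= e ->
  (forall z, `|z - x| <= `|y - x| -> `|space_gradient V t z - p| <= e) ->
  `|V t y - V t x - \sum_i (y 0 i - x 0 i) * p 0 i| <= n%:R * (`|y - x| * e).
Proof.
move=> tT e0 He.
have -> : V t y - V t x = \sum_(i < n) (V t (mix x y i.+1) - V t (mix x y i)).
  rewrite -(big_mkord xpredT (fun i => V t (mix x y i.+1) - V t (mix x y i))).
  rewrite telescope_sumr//; congr (V t _ - V t _); apply/rowP => j; rewrite mxE//.
  by rewrite ltn_ord.
rewrite -sumrB (le_trans (ler_norm_sum _ _ _))//.
rewrite (@le_trans _ _ (\sum_(i < n) `|y - x| * e))//; last first.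
  by rewrite sumr_const card_ord mulr_natl.
apply: ler_sum => i _.
have [c ci] := MVT_between 0 (y 0 i - x 0 i) (fun u => partial_is_derive (mix x y i) i u tT).
rewrite !subr0 scale0r addr0 in ci * => E.
have -> : mix x y i.+1 = mix x y i + (y 0 i - x 0 i) *: delta_mx 0 i.
  apply/rowP => j; rewrite !mxE eqxx/= ltnS leq_eqVlt.
  have [ji|ji] := eqVneq (j : nat) i; first have -> : j = i by apply/val_inj.
    by rewrite ltnn eqxx mulr1 addrC subrK.
  by rewrite (negbTE (_ : j != i)) ?mulr0 ?addr0.
rewrite E mulrC -mulrBr normrM.
have yx j : `|y 0 j - x 0 j| <= `|y - x|.
  by have := coord_le_norm (y - x) j; rewrite !mxE.
rewrite ler_pM//; set z := mix x y i + _.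
(* Coordinatewise, [z] differs from [x] by zero, by the full increment or by [c]; in the sup norm
   this stays in the ball. *)
have /He : `|z - x| <= `|y - x|.
  apply: norm_rV_le => // j; rewrite !mxE eqxx/=.
  have [->|ji] := eqVneq j i.
    by rewrite ltnn mulr1 addrAC subrr add0r (le_trans ci).
  by rewrite mulr0 addr0; case: ifP => _ //; rewrite subrr normr0.
by apply: le_trans; have := coord_le_norm (space_gradient V t z - p) i; rewrite !mxE.
Qed.

Lemma time_increment t s x c e : 0 <= t -> t <= s -> s <= T ->
  (forall r, t <= r <= s -> `|time_derivative T V r x - c| <= e) ->
  `|V s x - V t x - c * (s - t)| <= e * (s - t).
Proof.
move=> t0 ts sT He; have [_ _ cV _ _] := C1V.
have dV r : r \in `]t, s[%R -> is_derive r 1 (V ^~ x) (time_derivative T V r x).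
  rewrite in_itv/= => /andP[tr rs]; apply: time_is_derive.
  by rewrite (le_lt_trans t0)// (lt_le_trans rs).
have cx : {within `[t, s], continuous (V ^~ x)}.
  by apply: (slab_continuous_path cV t0 sT (X := cst x)) => r; exact: cvg_cst.
have [r rts ->] := MVT_segment ts dV cx.
by rewrite -mulrBl normrM [`|s - t|]ger0_norm ?subr_ge0// ler_wpM2r ?subr_ge0// He.
Qed.

Variables (f : R -> 'rV[R]_n -> 'rV[R]_n) (g : R -> 'rV[R]_n -> R).
Hypothesis cf : {within slab T, continuous (fun p => f p.1 p.2)}.
Hypothesis cg : {within slab T, continuous (fun p => g p.1 p.2)}.

(** Of [X] only closeness to [x] before [s] is asked, so that every controlled state qualifies up to
    its first impulse. The increment of [V] is taken in space at time [t], then in time at the end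
    point. *)
Lemma local_expansion t x e : 0 <= t <= T -> 0 < e ->
  exists2 d, 0 < d & forall s X, t <= s <= T -> s - t < d ->
    drift_integrable f X t s ->
    (leb R).-integrable `[t, s] (EFin \o (fun r => g r (X r))) ->
    (forall r, t <= r < s -> `|X r - x| < d) ->
    `|drift_path f t x X s - x| < d ->
    `|V s (drift_path f t x X s) - V t x + \int[leb R]_(r in `[t, s]) g r (X r)
      - HJ T f g V t x * (s - t)| <= e * (s - t).
Proof.
move=> tT e0; have /andP[t0 _] := tT.
have [_ _ _ cVt cVx] := C1V.
set p := space_gradient V t x; set q := f t x.
(* [M] collects the coefficients of [k * (s - t)] in [E1] to [E4]: one each from the time derivative
   and the running cost, the rest from the gradient and the drift. *)
pose M := 2 + n%:R * (`|q| + 1 + `|p|).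
have M0 : 0 < M by rewrite ltr_wpDr// mulr_ge0// !addr_ge0.
pose k := Num.min 1 (e / M).
have k0 : 0 < k by rewrite lt_min ltr01 divr_gt0.
have k1 : k <= 1 by rewrite ge_min lexx.
have kM : k * M <= e by rewrite -ler_pdivlMr// ge_min lexx orbT.
have [d1 d10 D1] := slab_continuityP x cVt tT k0.
have [d2 d20 D2] := slab_continuityP x cVx tT k0.
have [d3 d30 D3] := slab_continuityP x cf tT k0.
have [d4 d40 D4] := slab_continuityP x cg tT k0.
pose d := Num.min (Num.min d1 d2) (Num.min d3 d4).
have dE a : a < d -> [/\ a < d1, a < d2, a < d3 & a < d4].
  by rewrite !lt_min => /andP[/andP[? ?] /andP[? ?]].
exists d; first by rewrite !lt_min d10 d20 d30 d40.
move=> s X /andP[ts sT] std iX ig Xx; set y := drift_path f t x X s => yx.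
have inT r : t <= r <= s -> 0 <= r <= T /\ `|r - t| < d.
  move=> /andP[tr rs]; rewrite (le_trans t0)//= (le_trans rs)//; split=> //.
  by rewrite ger0_norm ?subr_ge0// (le_lt_trans _ std)// lerD2r.
have inT' r : t <= r < s -> 0 <= r <= T /\ `|r - t| < d.
  by move=> /andP[tr rs]; apply: inT; rewrite tr ltW.
have st0 : 0 <= s - t by rewrite subr_ge0.
have E1 : `|V s y - V t y - time_derivative T V t x * (s - t)| <= k * (s - t).
  apply: time_increment => // r /inT[rT /dE[rd _ _ _]]; have [yd _ _ _] := dE _ yx.
  exact/ltW/D1.
have E2 : `|V t y - V t x - \sum_i (y 0 i - x 0 i) * p 0 i| <=
    n%:R * (`|y - x| * k).
  apply: space_increment => //; first exact: ltW.
  move=> z zx; have [_ zd _ _] := dE _ (le_lt_trans zx yx).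
  by apply/ltW/D2 => //; rewrite subrr normr0.
have yE i : `|y 0 i - x 0 i - q 0 i * (s - t)| <= k * (s - t).
  rewrite /y /drift_path !mxE [_ + _ - x 0 i]addrAC subrr add0r.
  apply: integral_itv_near => // r /[dup] /inT'[rT /dE[_ _ rd _]] /Xx/dE[_ _ xd _].
  have := coord_le_norm (f r (X r) - q) i; rewrite !mxE => /le_trans; apply.
  exact/ltW/D3.
clearbody y.
have yx' : `|y - x| <= (`|q| + 1) * (s - t).
  apply: norm_rV_le => [|i]; first by rewrite mulr_ge0// addr_ge0.
  rewrite !mxE -[y 0 i - x 0 i](subrK (q 0 i * (s - t))).
  rewrite (le_trans (ler_normD _ _))// addrC mulrDl lerD//.
    by rewrite normrM [`|s - t|]ger0_norm// ler_wpM2r// coord_le_norm.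
  by rewrite (le_trans (yE i))// ler_wpM2r.
have E3 : `|\sum_i (y 0 i - x 0 i) * p 0 i - dot p q * (s - t)| <=
    n%:R * (k * (s - t) * `|p|).
  rewrite /dot mulr_suml -sumrB (le_trans (ler_norm_sum _ _ _))//.
  rewrite (@le_trans _ _ (\sum_(i < n) k * (s - t) * `|p|))//; last first.
    by rewrite sumr_const card_ord mulr_natl.
  apply: ler_sum => i _; rewrite -mulrA [p 0 i * _]mulrC -mulrBl normrM.
  by rewrite ler_pM// coord_le_norm.
have E4 : `|\int[leb R]_(r in `[t, s]) g r (X r) - g t x * (s - t)| <= k * (s - t).
  apply: integral_itv_near => // r /[dup] /inT'[rT /dE[_ _ _ rd]] /Xx/dE[_ _ _ xd].
  exact/ltW/D4.
apply: le_trans (_ : k * M * (s - t) <= _); last by rewrite ler_wpM2r.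
have E2' : n%:R * (`|y - x| * k) <= n%:R * ((`|q| + 1) * (s - t) * k).
  by rewrite ler_wpM2l// ler_wpM2r// ltW.
have -> : k * M * (s - t) = k * (s - t) + n%:R * ((`|q| + 1) * (s - t) * k) +
   n%:R * (k * (s - t) * `|p|) + k * (s - t) by rewrite /M; ring.
have -> : V s y - V t x + \int[leb R]_(r in `[t, s]) g r (X r)
      - HJ T f g V t x * (s - t) =
   (V s y - V t y - time_derivative T V t x * (s - t)) +
   (V t y - V t x - \sum_i (y 0 i - x 0 i) * p 0 i) +
   (\sum_i (y 0 i - x 0 i) * p 0 i - dot p q * (s - t)) +
   (\int[leb R]_(r in `[t, s]) g r (X r) - g t x * (s - t)).
  by rewrite /HJ -/p -/q; ring.
rewrite (le_trans (ler_normD _ _))// lerD//.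
rewrite (le_trans (ler_normD _ _))// lerD//.
by rewrite (le_trans (ler_normD _ _))// lerD// (le_trans E2).
Qed.

End Expansion.

(** * Minimisation over jumps *)

Section JumpMinimum.
Context {R : realType} {n : nat}.
Implicit Types (t s r : R) (x y z : 'rV[R]_n).
Variables (T L mu delta l0 delta0 beta : R) (alpha0 alpha : R -> R).
Variables (K : set 'rV[R]_n) (l : R -> 'rV[R]_n -> 'rV[R]_n -> R).
Hypotheses (l00 : 0 < l0) (beta0 : 0 < beta).
Hypothesis pos_alpha0 : positive_decreasing T alpha0.
Hypothesis cond_l :
  impulse_cost_condition T L mu delta l0 delta0 beta alpha0 alpha K l.
Hypothesis clK : closed K.

(** As [alpha0] decreases, [alpha0 T] bounds it below on [[0, T]], so the lower growth bound on [l]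
    confines the jump uniformly in [t] and [x]. *)
Lemma impulse_cost_coercive M : exists B : R,
  forall t x z, 0 <= t <= T -> K z -> l t x z <= M -> `|z| <= B.
Proof.
have [_ apos adec] := pos_alpha0; have [_ [_ [lb _]]] := cond_l.
exists ((`|M| / alpha0 T) `^ beta^-1) => t x z tT Kz lM.
have /andP[t0 tT'] := tT; have T0 : 0 <= T by rewrite (le_trans t0).
have aT : 0 < alpha0 T by rewrite apos// T0 lexx.
rewrite (le_trans (norm_le_enorm z))// leNgt; apply/negP => Bz.
have z0 : 0 <= enorm z by rewrite sqrtr_ge0.
have := gt0_ltr_powR beta0 _ _ Bz.
rewrite !nnegrE powR_ge0 z0 -powRrM mulVf ?gt_eqF// powRr1 ?divr_ge0// ?(ltW aT)//.
move=> /(_ isT isT); rewrite ltr_pdivrMr// ltNge => /negP; apply.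
have /andP[+ _] := lb t x z tT Kz; move=> /le_trans/(_ lM) le1.
apply: le_trans (_ : alpha0 t * enorm z `^ beta <= _).
  by rewrite mulrC ler_wpM2r ?powR_ge0// adec.
by rewrite (le_trans _ (ler_norm M))// (le_trans _ le1)// lerDr ltW.
Qed.

Lemma impulse_cost_continuityP t x z e : 0 <= t <= T -> K z -> 0 < e ->
  exists2 d, 0 < d & forall t' x' z', 0 <= t' <= T -> K z' -> `|t' - t| < d ->
    `|x' - x| < d -> `|z' - z| < d -> `|l t' x' z' - l t x z| < e.
Proof.
move=> tT Kz e0; have [/subspace_continuousP cl _] := cond_l.
have /cl/cvgrPdist_lt/(_ _ e0) : (slab T `*` K) (t, x, z).
  by split => //=; split=> //=; rewrite in_itv.
rewrite near_withinE => -[[A B]] /= [[[A1 A2] /= [/nbhs_ballP[d1 d10 A1d]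
  /nbhs_ballP[d2 d20 A2d]] A12] /nbhs_ballP[d3 d30 Bd]] AB.
exists (Num.min d1 (Num.min d2 d3)); first by rewrite !lt_min d10 d20.
move=> t' x' z' t'T Kz'; rewrite !lt_min => /and3P[t1 _ _] /and3P[_ x2 _] /and3P[_ _ z3].
rewrite distrC; apply: (AB (t', x', z')).
  split; last by apply: Bd; rewrite -ball_normE/= distrC.
  by apply: (A12 (t', x')); split; [apply: A1d|apply: A2d];
    rewrite -ball_normE/= distrC.
by split => //=; split => //=; rewrite in_itv.
Qed.

Lemma compact_jumps B : compact (K `&` [set z | `|z| <= B]).
Proof.
apply: bounded_closed_compact.
  by exists B; split; [exact: num_real|move=> M BM z [_ /= zB]; rewrite (le_trans zB)// ltW].
apply: closedI => //.
apply: (@preimage_closed _ _ (fun z : 'rV[R]_n => `|z|) [set r | r <= B]).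
  by move=> z _; exact: norm_continuous.
exact: closed_le.
Qed.

(** Since [G] is nonnegative, a jump costing more than the total for one fixed [z0] cannot win, and
    coercivity leaves a compact set. [K'] and [G] are general so as to cover both [Nset] and
    [NDset]. *)
Lemma jump_minimum (K' : set 'rV[R]_n) (G : 'rV[R]_n -> R) t x :
  0 <= t <= T -> K' !=set0 -> K' `<=` K -> closed K' ->
  continuous G -> (forall y, 0 <= G y) ->
  has_min [set G (x + z) + l t x z | z in K'].
Proof.
move=> tT [z0 K'z0] K'K clK' cG G0.
have [B BP] := impulse_cost_coercive (G (x + z0) + l t x z0).
have lB z : K' z -> l t x z <= G (x + z0) + l t x z0 -> `|z| <= B.
  by move=> /K'K; exact: BP.
have z0B : `|z0| <= B by apply: lB => //; rewrite lerDr.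
pose S := K' `&` (K `&` [set z | `|z| <= B]).
have cS : compact S by rewrite /S setIC; apply: compact_closedI => //; exact: compact_jumps.
have cphi : {within S, continuous (fun z => G (x + z) + l t x z)}.
  apply/subspace_continuousP => z [K'z [Kz _]]; apply/cvgrPdist_lt => e e0.
  have e2 : 0 < e / 2 by rewrite divr_gt0.
  have [d d0 dP] := impulse_cost_continuityP x tT Kz e2.
  have /cvgrPdist_lt/(_ _ e2)/nbhs_ballP[d' /= d'0 d'P] := cG (x + z).
  rewrite near_withinE; near=> z' => -[_ [Kz' _]].
  have zz' : `|z - z'| < Num.min d d'.
    by near: z'; apply: (@cvgr_dist_lt _ _ _ _ _ id) => //; rewrite lt_min d0.
  rewrite opprD addrACA (le_lt_trans (ler_normD _ _))// [ltRHS]splitr ltrD//.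
    apply: d'P; rewrite -ball_normE/= opprD addrACA subrr add0r.
    by move: zz'; rewrite lt_min => /andP[].
  rewrite distrC; apply: dP; rewrite ?subrr ?normr0//.
have [|c] := compact_EVT_min _ cS cphi; first by exists z0; split=> //; split=> //; exact: K'K.
rewrite inE => -[K'c _] cmin.
exists (G (x + c) + l t x c); first by exists c.
move=> _ [z K'z <-]; have [le1|gt1] := leP (l t x z) (G (x + z0) + l t x z0).
  by apply: cmin; rewrite inE; split=> //; split; [exact: K'K|exact: lB].
apply: (@le_trans _ _ (G (x + z0) + l t x z0)).
  by apply: cmin; rewrite inE; split=> //; split=> //; exact: K'K.
by rewrite (le_trans (ltW gt1))// lerDr.
Unshelve. all: by end_near. Qed.

(* The jumps to consider are confined to a compact set by coercivity, and the
   inequality propagates from a point to a neighbourhood uniformly on it. *)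
Lemma jump_gap_open (V : R -> 'rV[R]_n -> R) t0 x0 c :
  {within slab T, continuous (fun p => V p.1 p.2)} ->
  (forall t x, 0 <= t <= T -> 0 <= V t x) -> 0 <= t0 <= T ->
  (forall z, K z -> V t0 x0 + c < V t0 (x0 + z) + l t0 x0 z) ->
  exists2 d, 0 < d & forall t x, 0 <= t <= T -> `|t - t0| < d ->
    `|x - x0| < d -> forall z, K z -> V t x + c <= V t (x + z) + l t x z.
Proof.
move=> cV V0 t0T gap.
(* Near [(t0, x0)] the value is below [V t0 x0 + 1], so a jump costing more than this plus [c] has
   the gap by its cost alone, the value after it being nonnegative. *)
have [B BP] := impulse_cost_coercive (V t0 x0 + 1 + c).
have [dV dV0 dVP] := slab_continuityP x0 cV t0T ltr01.
pose P (p : R * 'rV[R]_n) z := 0 <= p.1 <= T -> K z ->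
  V p.1 p.2 + c <= V p.1 (p.2 + z) + l p.1 p.2 z.
have /compact_near_coveringP cov := @compact_jumps B.
have : \forall p \near (t0, x0), K `&` [set z | `|z| <= B] `<=` P p.
  apply: (cov _ (nbhs (t0, x0)) P) => z [Kz _].
  (* One third of the strict gap for each varying term: the impulse cost, and [V] before and after
     the jump. *)
  have g0 : 0 < (V t0 (x0 + z) + l t0 x0 z - (V t0 x0 + c)) / 3.
    by rewrite divr_gt0// subr_gt0 gap.
  set e := _ / 3 in g0.
  have [d1 d10 D1] := impulse_cost_continuityP x0 t0T Kz g0.
  have [d2 d20 D2] := slab_continuityP x0 cV t0T g0.
  have [d3 d30 D3] := slab_continuityP (x0 + z) cV t0T g0.
  pose d := Num.min d1 (Num.min d2 (d3 / 2)).
  have d0 : 0 < d by rewrite !lt_min d10 d20 divr_gt0.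
  exists (ball z d, ball (t0, x0) d) => /=.
    by split; exact: nbhsx_ballx.
  move=> [z' [t x]] /= [+ [+ +]] tT Kz'; rewrite -!ball_normE /= !lt_min.
  rewrite ![`|_ - z'|]distrC ![`|t0 - _|]distrC ![`|x0 - _|]distrC.
  move=> /and3P[z1 _ z3] /and3P[t1 t2 t3] /and3P[x1 x2 x3].
  have := D1 t x z' tT Kz' t1 x1 z1; have := D2 t x tT t2 x2.
  have xz : `|x + z' - (x0 + z)| < d3.
    rewrite opprD addrACA (le_lt_trans (ler_normD _ _))// [ltRHS]splitr.
    exact: ltrD.
  have t3' : `|t - t0| < d3 by lra.
  have := D3 t (x + z') tT t3' xz.
  by rewrite /e !ltr_norml => /andP[? ?] /andP[? ?] /andP[? ?]; lra.
move=> /nbhs_ballP[d /= d0 dP].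
exists (Num.min d dV); first by rewrite lt_min d0.
move=> t x tT; rewrite !lt_min => /andP[t1 t2] /andP[x1 x2] z Kz.
have [zB|zB] := leP `|z| B.
  by apply: (dP (t, x)) => //; split; rewrite -ball_normE/= distrC.
have lz : V t0 x0 + 1 + c < l t x z.
  by rewrite ltNge; apply/negP => /(BP _ _ _ tT Kz); rewrite leNgt zB.
have := dVP t x tT t2 x2; rewrite ltr_norml => /andP[_ ?].
by have := V0 t (x + z) tT; lra.
Qed.

End JumpMinimum.

(** * Dynamic programming *)

Section DynamicProgramming.
Context {R : realType} {n : nat}.
Implicit Types (t s r : R) (x y z : 'rV[R]_n) (X Y : R -> 'rV[R]_n).
Implicit Types (xi : seq (R * 'rV[R]_n)).
Variables (T : R) (K D : set 'rV[R]_n).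
Variables (f : R -> 'rV[R]_n -> 'rV[R]_n) (g : R -> 'rV[R]_n -> R).
Variables (h : 'rV[R]_n -> R) (l : R -> 'rV[R]_n -> 'rV[R]_n -> R).
Variables (L mu delta : R) (V : R -> 'rV[R]_n -> R).
Hypotheses (L0 : 0 < L) (mu0 : 0 < mu) (delta0 : 0 < delta).
Hypothesis cond_g : running_cost_condition T L mu delta g.
Hypothesis h_ge0 : forall x, 0 <= h x.
Hypothesis l_gt0 : forall t x z, 0 <= t <= T -> K z -> 0 < l t x z.
Hypothesis valueV :
  forall t x, 0 <= t <= T -> value T K D f g h l t x = (V t x)%:E.

Let g_integrable t x xi X : 0 <= t <= T -> trajectory T f t x xi X ->
  (leb R).-integrable `[t, T] (EFin \o (fun r => g r (X r))).
Proof. by move=> /andP[t0 tT]; exact: running_cost_integrable cond_g. Qed.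

Lemma value_le_cost t x xi X : 0 <= t <= T -> impulse_control T K t xi ->
  trajectory T f t x xi X -> closure D (X T) ->
  V t x <= cost T g h l t x xi X.
Proof.
move=> tT cxi tX DX; rewrite -lee_fin -valueV//.
by apply: ereal_inf_lbound; exists xi, X.
Qed.

Lemma value_adherent t x e : 0 <= t <= T -> 0 < e -> exists xi X,
  [/\ impulse_control T K t xi, trajectory T f t x xi X, closure D (X T) &
      cost T g h l t x xi X < V t x + e].
Proof.
move=> tT e0.
have vfin : value T K D f g h l t x \is a fin_num by rewrite valueV.
have [_ [xi [X [cxi tX DX ->]]]] := lb_ereal_inf_adherent e0 vfin.
rewrite -/(value T K D f g h l t x) valueV// -EFinD lte_fin => cV.
by exists xi, X.
Qed.

Lemma value_ge0 t x : 0 <= t <= T -> 0 <= V t x.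
Proof.
move=> tT; rewrite -lee_fin -valueV//.
apply: le_ereal_inf_tmp => _ [xi [X [[_ xiP] _ _ ->]]].
have [_ gb _] := cond_g; have /andP[t0 _] := tT.
rewrite lee_fin !addr_ge0//.
  apply: Rintegral_ge0 => r /=; rewrite in_itv/= => /andP[tr rT].
  have rT0 : 0 <= r <= T by rewrite (le_trans t0).
  by have /andP[] := gb r (X r) rT0.
apply: sumr_ge0 => k _.
have /xiP[/andP[tk kT] Kk] := mem_nth (0, 0) (ltn_ord k).
by rewrite ltW// l_gt0// (le_trans t0).
Qed.

Lemma impulse_controlS t s xi : t <= s -> impulse_control T K s xi ->
  impulse_control T K t xi.
Proof.
move=> ts [sxi xiP]; split=> // p /xiP[/andP[sp pT] Kp].
by rewrite pT (le_trans ts).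
Qed.

Lemma impulse_control_from t s xi : (forall p, p \in xi -> s <= p.1) ->
  impulse_control T K t xi -> impulse_control T K s xi.
Proof.
move=> xis [sxi xiP]; split=> // p pxi; have [/andP[_ ->] Kp] := xiP _ pxi.
by rewrite xis.
Qed.

Lemma impulse_control_cons t z xi : t <= T -> K z ->
  impulse_control T K t xi -> impulse_control T K t ((t, z) :: xi).
Proof.
move=> tT Kz [sxi xiP]; split.
  rewrite /= path_min_sorted//; apply/allP => _ /mapP[p /xiP[/andP[tp _] _] ->].
  exact: tp.
by move=> p; rewrite inE => /predU1P[->/=|/xiP//]; rewrite lexx.
Qed.

Lemma impulse_control_behead t p xi : impulse_control T K t (p :: xi) ->
  [/\ t <= p.1 <= T, K p.2, (forall q, q \in p :: xi -> p.1 <= q.1) &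
      impulse_control T K p.1 xi].
Proof.
move=> [/= sxi xiP]; have [pT Kp] := xiP _ (mem_head _ _).
have pxi q : q \in xi -> p.1 <= q.1.
  move=> qxi; have := order_path_min le_trans sxi.
  by move=> /allP; apply; exact: map_f.
split=> //; first by move=> q; rewrite inE => /predU1P[->//|]; exact: pxi.
apply: (impulse_control_from (t := t)) => //; split; first exact: path_sorted sxi.
by move=> q qxi; apply: xiP; rewrite inE qxi orbT.
Qed.

Lemma value_le_jump t x z : 0 <= t <= T -> K z ->
  V t x <= V t (x + z) + l t x z.
Proof.
move=> tT Kz; apply/ler_addgt0Pr => e e0.
have [xi [X [cxi tX DX cV]]] := value_adherent (x + z) tT e0.
have /andP[t0 tT'] := tT.
have := value_le_cost tT (impulse_control_cons tT' Kz cxi)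
  ((trajectory_prepend _ _ _ _ _ _ _).2 tX) DX.
by rewrite cost_prepend; lra.
Qed.

Lemma value_le_drift t s x Y : 0 <= t -> t <= s -> s <= T ->
  {within `[t, s], continuous Y} -> drift_integrable f Y t s ->
  (forall r, t <= r <= s -> Y r = drift_path f t x Y r) ->
  V t x <= \int[leb R]_(r in `[t, s]) g r (Y r) + V s (Y s).
Proof.
move=> t0 ts sT cY iY eY; apply/ler_addgt0Pr => e e0.
have sT' : 0 <= s <= T by rewrite sT (le_trans t0).
have tT' : 0 <= t <= T by rewrite t0 (le_trans ts).
have [xi [X2 [cxi tX2 DX2 cV]]] := value_adherent (Y s) sT' e0.
have xis p : p \in xi -> s <= p.1 by move=> /cxi.2[/andP[]].
have tX := trajectory_cat ts sT xis iY eY tX2.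
set X := fun r => _ in tX.
have YX r : t <= r < s -> Y r = X r by move=> /andP[_ rs]; rewrite /X rs.
have XX2 r : s <= r <= T -> X r = X2 r.
  by move=> /andP[sr _]; rewrite /X ltNge sr.
have DX : closure D (X T) by rewrite XX2// sT lexx.
have := value_le_cost tT' (impulse_controlS ts cxi) tX DX.
rewrite (cost_split _ _ ts sT xis tX (g_integrable tT' tX)).
(* The tail starts from [Y s], whereas the spliced path has at [s] the value of [X2], impulses
   included. *)
have [_ <-] := eq_drift_path_left x ts YX iY; rewrite -eY ?ts ?lexx//.
rewrite (eq_cost _ _ _ _ sT _ XX2); last by move=> p /cxi.2[].
have [cg _ _] := cond_g.
have gY : (leb R).-integrable `[t, s] (EFin \o (fun r => g r (Y r))).
  by apply: continuous_itv_integrable; exact: slab_continuous_path cg _ _ _.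
have [|_ <-] := @eq_integral_itvo _ t s _ (fun r => g r (X r)) ts _ gY.
  by move=> r /YX ->.
lra.
Qed.

Lemma cost_ge_drift t s x xi X : 0 <= t -> t <= s -> s <= T ->
  (forall p, p \in xi -> s <= p.1) -> impulse_control T K t xi ->
  trajectory T f t x xi X -> closure D (X T) ->
  \int[leb R]_(r in `[t, s]) g r (X r) + V s (drift_path f t x X s) <=
  cost T g h l t x xi X.
Proof.
move=> t0 ts sT xis cxi tX DX.
have tT' : 0 <= t <= T by rewrite t0 (le_trans ts).
rewrite (cost_split _ _ ts sT xis tX (g_integrable tT' tX)) lerD2l.
apply: value_le_cost => //; first by rewrite sT (le_trans t0).
  exact: impulse_control_from cxi.
exact: trajectory_split tX.
Qed.

(** Only the first impulse is split off; further impulses at the same time [s] stay in the tail,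
    whose cost is bounded by [V s] at the state after the jump. *)
Lemma cost_ge_jump t s z x xi X : 0 <= t ->
  impulse_control T K t ((s, z) :: xi) ->
  trajectory T f t x ((s, z) :: xi) X -> closure D (X T) ->
  \int[leb R]_(r in `[t, s]) g r (X r) +
    (V s (drift_path f t x X s + z) + l s (drift_path f t x X s) z) <=
  cost T g h l t x ((s, z) :: xi) X.
Proof.
move=> t0 cxi tX DX.
have [/= /andP[ts sT] Kz xis cxi'] := impulse_control_behead cxi.
have tT' : 0 <= t <= T by rewrite t0 (le_trans ts).
have sT' : 0 <= s <= T by rewrite sT (le_trans t0).
rewrite (cost_split _ _ ts sT xis tX (g_integrable tT' tX)) lerD2l.
rewrite cost_prepend addrC lerD2l; apply: value_le_cost => //.
exact/trajectory_prepend/(trajectory_split ts sT tX).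
Qed.

End DynamicProgramming.

(** The three bounds are the time range of [local_expansion], the smallness required by [picard] and
    [short_time_bound], and the displacement from the latter, with [A] standing for 1 plus the norm
    of [x]. *)
Lemma short_horizon {R : realType} (T C A t d : R) : 0 < C -> 0 < A -> t < T ->
  0 < d -> exists2 u, 0 < u & t + u <= T /\ forall s, t <= s <= t + u ->
    [/\ s - t < d, C * (s - t) <= 2^-1 & 2 * (C * (s - t) * A) < d].
Proof.
move=> C0 A0 tT d0.
pose u := Num.min (Num.min (T - t) (d / 2)) (Num.min (2^-1 / C) (d / 4 / (C * A))).
have CA0 : 0 < C * A by rewrite mulr_gt0.
have u0 : 0 < u by rewrite !lt_min subr_gt0 tT !divr_gt0.
have : u <= u by []. rewrite {2}/u !le_min => /andP[/andP[u1 u2] /andP[u3 u4]].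
exists u => //; split; first lra.
move=> s /andP[ts su]; have su' : s - t <= u by lra.
split; first lra.
  have := le_trans su' u3; rewrite ler_pdivlMr//; lra.
have := le_trans su' u4; rewrite ler_pdivlMr//; lra.
Qed.

(** The sum is twice the midpoint. *)
Lemma convex_coneD {R : realType} {n : nat} (K : set 'rV[R]_n) x y :
  closed_convex_cone K -> K x -> K y -> K (x + y).
Proof.
move=> [_ _ cK sK] Kx Ky.
have h0 : 0 <= (2^-1 : R) by rewrite invr_ge0.
have h1 : (2^-1 : R) <= 1 by rewrite invf_le1 ?ler1n.
have := cK x y (Itv01 h0 h1); rewrite !inE => /(_ Kx Ky) Kxy.
have := sK 2 _ (ler0n _ 2) Kxy; rewrite /(conv _ _ _)/=.
suff -> : 2 *: (2^-1 *: x + unstable.onem 2^-1 *: y) = x + y by [].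
rewrite scalerDr !scalerA mulfV// scale1r; congr (_ + _).
by rewrite /unstable.onem mulrBr mulfV// mulr1 (_ : 2 - 1 = 1) ?scale1r//; lra.
Qed.

Lemma within_continuous_coord {R : realType} {n : nat} (S : topologicalType)
    (A : set S) (F : S -> 'rV[R]_n) i :
  {within A, continuous F} -> {within A, continuous (fun p => F p 0 i)}.
Proof.
move=> cF p; apply: (@continuous_comp (subspace A) _ _ F (fun M => M 0 i) p).
  exact: cF.
exact: coord_continuous.
Qed.


(** * The Hamilton-Jacobi inequality and complementarity before the terminal time *)

Section HamiltonJacobi.
Context {R : realType} {n : nat}.
Implicit Types (t s r : R) (x y z : 'rV[R]_n) (X Y : R -> 'rV[R]_n).
Implicit Types (xi : seq (R * 'rV[R]_n)).
Variables (T : R) (K D : set 'rV[R]_n).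
Variables (f : R -> 'rV[R]_n -> 'rV[R]_n) (g : R -> 'rV[R]_n -> R).
Variables (h : 'rV[R]_n -> R) (l : R -> 'rV[R]_n -> 'rV[R]_n -> R).
Variables (Lf L mu delta : R) (V : R -> 'rV[R]_n -> R).
Hypotheses (Lf0 : 0 < Lf) (L0 : 0 < L) (mu0 : 0 < mu) (delta0 : 0 < delta).
Hypothesis cond_f : drift_condition T Lf f.
Hypothesis cond_g : running_cost_condition T L mu delta g.
Hypothesis valueV :
  forall t x, 0 <= t <= T -> value T K D f g h l t x = (V t x)%:E.
Hypothesis C1V : C1_slab T V.

(** At [t = T] there is no later time to drift to; this continuity transfers the sign of [HJ]
    between [T] and earlier times. *)
Lemma HJ_continuous :
  {within slab T, continuous (fun p => HJ T f g V p.1 p.2)}.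
Proof.
have [_ _ _ cVt cVx] := C1V; have [cf _ _] := cond_f; have [cg _ _] := cond_g.
move=> p; apply: cvgD; last exact: cg.
apply: cvgD; first exact: cVt.
rewrite /dot; apply: cvg_big => [|i _]; first exact: add_continuous.
by apply: cvgM; [exact: within_continuous_coord cVx _|
  exact: within_continuous_coord cf _].
Qed.

Let cf : {within slab T, continuous (fun p => f p.1 p.2)}.
Proof. by have [] := cond_f. Qed.

Let cg : {within slab T, continuous (fun p => g p.1 p.2)}.
Proof. by have [] := cond_g. Qed.

Let C := sup_lip (n := n) Lf.

Let C0 : 0 < C. Proof. exact: sup_lip_gt0. Qed.

Lemma HJ_ge0_interior t x : 0 <= t < T -> 0 <= HJ T f g V t x.
Proof.
move=> /andP[t0 tT]; have tT' : 0 <= t <= T by rewrite t0 ltW.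
(* With this error rate the expansion over time [u] gives at most half of [HJ] times [u], which is
   negative and contradicts [value_le_drift]. *)
rewrite leNgt; apply/negP => HJ0; pose e := - HJ T f g V t x / 2.
have e0 : 0 < e by rewrite divr_gt0// oppr_gt0.
have [d d0 dP] := local_expansion C1V cf cg x tT' e0.
have A0 : 0 < 1 + `|x| by rewrite ltr_wpDr.
have [u u0 [tuT uP]] := short_horizon C0 A0 tT d0.
have ts : t <= t + u by rewrite lerDl ltW.
have [| sd small Ad] := uP (t + u); first by rewrite ts lexx.
have [Y [cY iY eY]] := picard Lf0 cond_f x t0 ts tuT small.
have [|Yx yx] := short_time_bound Lf0 cond_f t0 ts tuT small iY (x := x).
  by move=> r /andP[tr rs]; apply: eY; rewrite tr ltW.
have gY : (leb R).-integrable `[t, t + u] (EFin \o (fun r => g r (Y r))).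
  by apply: continuous_itv_integrable; exact: slab_continuous_path cg _ _ _.
have := dP (t + u) Y _ sd iY gY.
rewrite ts tuT => /(_ isT) {}dP.
have {}dP := dP (fun r rs => le_lt_trans (Yx r rs) Ad) (le_lt_trans yx Ad).
have := value_le_drift L0 mu0 delta0 cond_g valueV t0 ts tuT cY iY eY.
rewrite eY ?ts ?lexx// => Vle.
move: dP; rewrite ler_norml => /andP[_].
have -> : t + u - t = u by rewrite addrAC subrr add0r.
have : HJ T f g V t x * u < 0 by rewrite nmulr_rlt0.
by rewrite /e; lra.
Qed.

(* A control without impulses before [t + u] costs at least [V t x + HJ / 2 * u];
   one with an earlier impulse costs at least [V t x + c]. *)
Lemma no_double_gap t x c : 0 <= t < T -> 0 < HJ T f g V t x -> 0 < c ->
  (exists2 d, 0 < d & forall t' x', 0 <= t' <= T -> `|t' - t| < d ->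
    `|x' - x| < d -> forall z, K z -> V t' x' + c <= V t' (x' + z) + l t' x' z) ->
  False.
Proof.
move=> /andP[t0 tT] HJ0 c0 [d1 d10 gap].
have tT' : 0 <= t <= T by rewrite t0 ltW.
pose e := HJ T f g V t x / 2.
have e0 : 0 < e by rewrite divr_gt0.
have [d2 d20 d2P] := local_expansion C1V cf cg x tT' e0.
pose d := Num.min d1 d2.
have d0 : 0 < d by rewrite lt_min d10.
have dE a : a < d -> a < d1 /\ a < d2 by rewrite lt_min => /andP[].
have A0 : 0 < 1 + `|x| by rewrite ltr_wpDr.
have [u u0 [tuT uP]] := short_horizon C0 A0 tT d0.
(* Used at [s = t + u] and at the time of an early first impulse, where the second conclusion keeps
   the state in the region of [gap]. *)
have gain xi X s : t <= s <= t + u -> (forall p, p \in xi -> s <= p.1) ->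
    trajectory T f t x xi X -> let y := drift_path f t x X s in
    V t x + e * (s - t) <= \int[leb R]_(r in `[t, s]) g r (X r) + V s y /\
    `|y - x| < d.
  move=> tsu xis tX; have /andP[ts su] := tsu; have sT := le_trans su tuT.
  have [sd small Ad] := uP s tsu.
  have /trajectoryP[iX _] := tX.
  have iXs : drift_integrable f X t s.
    by move=> i; apply: integrable_itvS (iX i).
  have [Yx yx] := short_time_bound Lf0 cond_f t0 ts sT small iXs
    (trajectory_before sT xis tX).
  have gX : (leb R).-integrable `[t, s] (EFin \o (fun r => g r (X r))).
    have := running_cost_integrable t0 (ltW tT) L0 mu0 delta0 cond_g tX.
    exact: integrable_itvS.
  split; last exact: le_lt_trans Ad.
  have [_ sd2] := dE _ sd; have [_ Ad2] := dE _ Ad.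
  have := d2P s X _ sd2 iXs gX.
  rewrite ts sT => /(_ isT) {}dP.
  have := dP (fun r rs => le_lt_trans (Yx r rs) Ad2) (le_lt_trans yx Ad2).
  by rewrite ler_norml => /andP[+ _]; rewrite /e; lra.
(* The tolerance is the smaller of the two excesses, so a near-optimal control is excluded in either
   case. *)
have m0 : 0 < Num.min c (e * u) by rewrite lt_min c0 mulr_gt0.
have [xi [X [cxi tX DX]]] := value_adherent valueV x tT' m0.
rewrite ltNge => /negP; apply; rewrite -lerBrDl ge_min.
have tu : t <= t + u by rewrite lerDl ltW.
have wait : (forall p, p \in xi -> t + u <= p.1) ->
    e * u <= cost T g h l t x xi X - V t x.
  move=> xis; have [|+ _] := gain xi X (t + u) _ xis tX; first by rewrite tu lexx.
  have := cost_ge_drift L0 mu0 delta0 cond_g valueV t0 tu tuT xis cxi tX DX.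
  by rewrite [t + u - t]addrAC subrr add0r; lra.
case: xi cxi tX wait => [|[s z] xi] cxi tX wait; first by rewrite wait ?orbT.
have [/= /andP[ts sT] Kz xis _] := impulse_control_behead cxi.
have [ust|stu] := leP (t + u) s.
  by rewrite wait ?orbT// => p /xis; exact: le_trans.
have [|+ yx] := gain _ X s _ xis tX; first by rewrite ts ltW.
have [|sd _ _] := uP s; first by rewrite ts ltW.
have sT' : 0 <= s <= T by rewrite sT (le_trans t0).
have [sd1 _] := dE _ sd; have [yx1 _] := dE _ yx.
have st : `|s - t| < d1 by rewrite ger0_norm ?subr_ge0.
have := gap s _ sT' st yx1 z Kz.
have := cost_ge_jump L0 mu0 delta0 cond_g valueV t0 cxi tX DX.
have : 0 <= e * (s - t) by rewrite mulr_ge0 ?subr_ge0// ltW.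
move=> h1 h2 h3 h4; apply/orP; left; lra.
Qed.

End HamiltonJacobi.

(** * The terminal condition and the theorem *)

Section Terminal.
Context {R : realType} {n : nat}.
Implicit Types (x y z : 'rV[R]_n) (X : R -> 'rV[R]_n).
Implicit Types (xi : seq (R * 'rV[R]_n)).
Variables (T : R) (K D : set 'rV[R]_n).
Variables (f : R -> 'rV[R]_n -> 'rV[R]_n) (g : R -> 'rV[R]_n -> R).
Variables (h : 'rV[R]_n -> R) (l : R -> 'rV[R]_n -> 'rV[R]_n -> R).

Lemma cost_terminal_nil x X :
  cost T g h l T x [::] X = h (X T).
Proof.
by rewrite /cost set_itv1 Rintegral_set1 add0r big_ord0 addr0.
Qed.

Lemma trajectory_terminal_nil x : trajectory T f T x [::] (cst x).
Proof.
apply/trajectoryP; split.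
  move=> i; apply: continuous_itv_integrable; rewrite set_itv1.
  exact: continuous_subspace1.
move=> s sT; have -> : s = T by apply/le_anti; rewrite andbC.
by rewrite drift_path_start /impulse_path big_nil addr0.
Qed.

Lemma trajectory_terminal_nilE x X : trajectory T f T x [::] X -> X T = x.
Proof.
move=> /trajectoryP[_ ->]; last by rewrite lexx.
by rewrite drift_path_start /impulse_path big_nil addr0.
Qed.

Hypothesis cone_K : closed_convex_cone K.
Hypothesis subadd_l : forall x z z', K z -> K z' ->
  l T x (z + z') <= l T x z + l T (x + z) z'.

(** At [T] the running cost vanishes and only jumps move the state. The tail is first merged into
    one jump [z'] from [x + z], then fused with [z]; the equation for [X T] carries the terminal
    constraint over to the merged jump. *)
Lemma cost_terminal_ge x xi X : xi != [::] -> impulse_control T K T xi ->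
  trajectory T f T x xi X ->
  exists2 z, K z & X T = x + z /\ h (x + z) + l T x z <= cost T g h l T x xi X.
Proof.
elim: xi x => // -[s z] xi IH x _ cxi tX.
have [/= /le_anti sT Kz _ cxi'] := impulse_control_behead cxi.
rewrite -{}sT in cxi tX cxi' *.
move: tX => /trajectory_prepend tX; rewrite cost_prepend.
have [xi0|xi_neq0] := eqVneq xi [::].
  rewrite xi0 in tX *; exists z => //; rewrite cost_terminal_nil.
  by rewrite (trajectory_terminal_nilE tX); split=> //; rewrite addrC.
have [z' Kz' [XE cz']] := IH (x + z) xi_neq0 cxi' tX.
exists (z + z'); first exact: convex_coneD.
rewrite addrA XE; split=> //.
by have := subadd_l x Kz Kz'; lra.
Qed.

End Terminal.

Lemma has_min_inf {R : realType} (S : set R) : has_min S ->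
  S (inf S) /\ lbound S (inf S).
Proof.
move=> [m Sm mS]; suff -> : inf S = m by [].
apply/le_anti/andP; split; first by apply: ge_inf => //; exists m.
by apply: lb_le_inf => //; exists m.
Qed.

Theorem theorem4p3 (R : realType) (n : nat) (T : R)
    (K D : set 'rV[R]_n)
    (f : R -> 'rV[R]_n -> 'rV[R]_n)
    (g : R -> 'rV[R]_n -> R)
    (h : 'rV[R]_n -> R)
    (l : R -> 'rV[R]_n -> 'rV[R]_n -> R)
    (Lf L mu delta l0 delta0 beta : R) (alpha0 alpha : R -> R)
    (V : R -> 'rV[R]_n -> R) :
  (0 < n)%N -> 0 < T ->
  target_condition K D ->
  0 < Lf -> drift_condition T Lf f ->
  0 < L -> 0 < mu -> 0 < delta <= 1 ->
  running_cost_condition T L mu delta g ->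
  terminal_cost_condition L mu delta h ->
  0 < l0 -> 0 < delta0 -> 0 < beta <= 1 ->
  positive_decreasing T alpha0 -> positive_decreasing T alpha ->
  impulse_cost_condition T L mu delta l0 delta0 beta alpha0 alpha K l ->
  terminal_impulse_condition T K D h l ->
  (forall t x, 0 <= t <= T -> value T K D f g h l t x = (V t x)%:E) ->
  C1_slab T V ->
  (* the minima defining N[V] and N^D[h] exist *)
  ((forall t x, 0 <= t <= T -> has_min (Nset K l V t x)) /\
   (forall x, has_min (NDset T K D l h x))) /\
  ((forall t x, 0 <= t <= T ->
      HJ T f g V t x >= 0 /\ Nop K l V t x - V t x >= 0) /\
   (forall t x, 0 <= t <= T ->
      HJ T f g V t x * (Nop K l V t x - V t x) = 0) /\
   (forall x, V T x = hD T K D l h x)) /\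
  ((forall t x, 0 <= t < T ->
      Num.min (HJ T f g V t x) (Nop K l V t x - V t x) = 0) /\
   (forall x, V T x = hD T K D l h x)).
Proof.
move=> _ T0 [cone_K [D0 _ _ _] _ targ] Lf0 cond_f L0 mu0 /andP[delta_gt0 _] cond_g cond_h.
move=> l00 delta00 /andP[beta0 _] pos_alpha0 _ cond_l _ valueV C1V.
have [K0 clK _ _] := cone_K.
have [_ [l_gt0 [_ [_ [subadd _]]]]] := cond_l.
have [ch hb _] := cond_h.
have h_ge0 x : 0 <= h x by have /andP[] := hb x.
have [_ _ cV _ _] := C1V.
have V_ge0 := value_ge0 cond_g h_ge0 l_gt0 valueV.
have TT : 0 <= T <= T by rewrite ltW/=.
have Vmin t x : 0 <= t <= T -> has_min (Nset K l V t x).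
  move=> tT; apply: (jump_minimum l00 beta0 pos_alpha0 cond_l clK) => //.
  - by exists 0.
  - exact: slab_continuous_slice cV tT.
  - by move=> y; exact: V_ge0.
have hmin x : has_min (NDset T K D l h x).
  apply: (jump_minimum l00 beta0 pos_alpha0 cond_l clK) => //.
  (* An admissible jump into [D]: for [K = setT] aim at any point of [D]; otherwise write [x] as
     [y - z] with [y] in [D], [z] in [K], and jump by [z]. *)
  - case: targ => [[_ KT]|[_ DK]].
      have [y Dy] := D0; exists (y - x); split; first by rewrite KT.
      by rewrite addrC subrK; exact: subset_closure.
    have : [set p.1 - p.2 | p in D `*` K] x by rewrite DK.
    move=> [[y z] /= [Dy Kz] <-]; exists z; split=> //.
    by rewrite subrK; exact: subset_closure.
  - by move=> z [].
  - apply: closedI => //; apply: (@preimage_closed _ _ (fun z => x + z)).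
      move=> z _.
      apply: (@cvgD _ _ _ (nbhs z) (nbhs_filter z) (cst x) id).
        exact: cvg_cst.
      exact: cvg_id.
    exact: closed_closure.
have Ngap t x : 0 <= t <= T -> 0 <= Nop K l V t x - V t x.
  move=> tT; rewrite subr_ge0 /Nop; have [[z Kz <-] _] := has_min_inf (Vmin t x tT).
  exact: (value_le_jump valueV).
have near_T d : 0 < d -> exists2 t, 0 <= t < T & `|t - T| < d.
  move=> d0; exists (Num.max 0 (T - d / 2)).
    rewrite le_max lexx/= gt_max T0/=; lra.
  rewrite ltr0_norm; last by rewrite subr_lt0 gt_max T0/=; lra.
  by rewrite opprB ltrBlDr -ltrBlDl lt_max; apply/orP; right; lra.
have HJnear x e : 0 < e -> exists2 d, 0 < d & forall t, 0 <= t <= T ->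
    `|t - T| < d -> `|HJ T f g V t x - HJ T f g V T x| < e.
  move=> e0.
  have [d d0 dP] := slab_continuityP x (HJ_continuous cond_f cond_g C1V) TT e0.
  by exists d => // t tT td; apply: dP => //; rewrite subrr normr0.
have HJ_ge0 t x : 0 <= t <= T -> 0 <= HJ T f g V t x.
  move=> /andP[t0]; rewrite le_eqVlt => /predU1P[->|tT]; last first.
    by apply: (HJ_ge0_interior Lf0 L0 mu0 delta_gt0 cond_f cond_g valueV C1V); rewrite t0.
  rewrite leNgt; apply/negP => HJ0.
  have [d d0 dP] := HJnear x (- HJ T f g V T x) ltac:(by rewrite oppr_gt0).
  have [s /[dup] sT /andP[s0 sT'] sd] := near_T d d0.
  have := HJ_ge0_interior Lf0 L0 mu0 delta_gt0 cond_f cond_g valueV C1V x sT.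
  have := dP s _ sd; rewrite s0 ltW// => /(_ isT).
  by rewrite ltr_norml; lra.
(* The strict bound on [c] is the slack spent in passing to neighbouring points. *)
have gap_open t x c : 0 <= t <= T -> c < Nop K l V t x - V t x ->
    exists2 d, 0 < d & forall t' x', 0 <= t' <= T -> `|t' - t| < d ->
    `|x' - x| < d -> forall z, K z -> V t' x' + c <= V t' (x' + z) + l t' x' z.
  move=> tT cN.
  apply: (jump_gap_open l00 beta0 pos_alpha0 cond_l clK cV V_ge0 tT) => z Kz.
  have [_ Nlb] := has_min_inf (Vmin t x tT).
  have := Nlb _ (ex_intro2 _ _ z Kz erefl); rewrite -/(Nop K l V t x); lra.
have slack0 t x : 0 <= t < T -> 0 < HJ T f g V t x ->
    0 < Nop K l V t x - V t x -> False.
  move=> tT HJ0 N0; have /andP[t0 tT'] := tT.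
  have c0 : 0 < (Nop K l V t x - V t x) / 2 by rewrite divr_gt0.
  have tT2 : 0 <= t <= T by rewrite t0 ltW.
  apply: (no_double_gap Lf0 L0 mu0 delta_gt0 cond_f cond_g valueV C1V tT HJ0 c0).
  by apply: gap_open => //; lra.
have compl t x : 0 <= t <= T -> HJ T f g V t x * (Nop K l V t x - V t x) = 0.
  move=> tT; apply/eqP; rewrite mulf_eq0; apply/negPn/negP; rewrite negb_or.
  move=> /andP[HJn Nn].
  have HJ0 : 0 < HJ T f g V t x by rewrite lt_neqAle eq_sym HJn HJ_ge0.
  have N0 : 0 < Nop K l V t x - V t x by rewrite lt_neqAle eq_sym Nn Ngap.
  have /andP[t0] := tT; rewrite le_eqVlt => /predU1P[tE|tT']; last first.
    by apply: (@slack0 t x); rewrite ?t0.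
  rewrite {}tE in HJ0 N0.
  have c0 : 0 < (Nop K l V T x - V T x) / 2 by rewrite divr_gt0.
  (* Half of the gap at [T] survives at nearby earlier times, and so does the sign of [HJ]; [slack0]
     then applies at such a time. *)
  have [d1 d10 gap] := @gap_open T x ((Nop K l V T x - V T x) / 2) TT ltac:(lra).
  have [d2 d20 dP] := HJnear x _ HJ0.
  have [s /[dup] sT /andP[s0 sT']] := near_T (Num.min d1 d2) ltac:(by rewrite lt_min d10).
  have sT2 : 0 <= s <= T by rewrite s0 ltW.
  rewrite lt_min => /andP[sd1 sd2]; apply: (@slack0 s x) => //.
    by have := dP s sT2 sd2; rewrite ltr_norml; lra.
  (* The infimum is attained, so the bound for single jumps holds for [Nop] at [s]. *)
  have [[z Kz Nz] _] := has_min_inf (Vmin s x sT2).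
  rewrite -/(Nop K l V s x) in Nz.
  have := gap s x sT2 sd1 _ z Kz; rewrite subrr normr0 Nz => /(_ d10); lra.
(* The minimum over the two orders is at most the cost in the order of application, and [delta0] is
   positive. *)
have subadd_T x z z' : K z -> K z' -> l T x (z + z') <= l T x z + l T (x + z) z'.
  move=> Kz Kz'; have := subadd T x z z' TT Kz Kz'.
  rewrite lerBrDr le_min => /andP[+ _]; lra.
have terminal x : V T x = hD T K D l h x.
  have [[z0 [Kz0 Dz0] hz0] hlb] := has_min_inf (hmin x).
  rewrite -/(NDop T K D l h x) in hz0 hlb.
  have V_le_h y : closure D y -> V T y <= h y.
    move=> Dy; rewrite -(cost_terminal_nil T g h l y (cst y)).
    apply: (value_le_cost valueV TT) => //.
    exact: trajectory_terminal_nil.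
  have V_le_ND : V T x <= NDop T K D l h x.
    rewrite -hz0; apply: le_trans (value_le_jump valueV x TT Kz0) _.
    by rewrite lerD2r; exact: V_le_h.
  apply/le_anti/andP; split.
    rewrite /hD; case: ifPn => // /[!inE] Dx.
    by rewrite le_min V_le_ND V_le_h.
  apply/ler_addgt0Pr => e e0.
  have [xi [X [cxi tX DX /ltW]]] := value_adherent valueV x TT e0.
  apply: le_trans.
  (* An empty list leaves the state at [x], so admissibility puts [x] in [closure D], the branch of
     [hD] that contains [h x]; a nonempty one costs at least [NDop], which bounds [hD] in both
     branches. *)
  have [xi0|xi_neq0] := eqVneq xi [::].
    rewrite xi0 in tX *; rewrite cost_terminal_nil.
    rewrite (trajectory_terminal_nilE tX) in DX *.
    by rewrite /hD ifT ?inE// ge_min lexx.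
  have [z Kz [XE]] := cost_terminal_ge g h cone_K subadd_T xi_neq0 cxi tX.
  apply: le_trans; rewrite XE in DX.
  apply: le_trans (_ : NDop T K D l h x <= _); last by apply: hlb; exists z.
  by rewrite /hD; case: ifP => // _; rewrite ge_min lexx orbT.
split; first by split.
split; first by split=> [t x tT|]; [split; [exact: HJ_ge0|exact: Ngap]|].
split=> // t x /andP[t0 /ltW tT].
have tT' : 0 <= t <= T by rewrite t0.
have := compl t x tT' => /eqP; rewrite mulf_eq0 => /orP[/eqP->|/eqP->].
  by rewrite min_l// Ngap.
by rewrite min_r// HJ_ge0.
Qed.
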